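(* Let $X$ be a nonempty shift of finite type (SFT) with entropy $\mathbf{h}(X)=\log\lambda$. For $n\in\mathbb{N}$ let $\mathcal{E}_n\subset\Omega_n$ be the event that the random SFT $X_\omega$ is empty. Then for every $\alpha\in[0,1]$, $$\lim_{n\to\infty}\mathbb{P}_\alpha(\mathcal{E}_n)=\begin{cases}(\zeta_X(\alpha))^{-1}, & \text{if }\alpha\in[0,1/\lambda),\\ 0, & \text{if }\alpha\in[1/\lambda,1].\end{cases}$$
   Context: SFTs. Let $\mathcal{A}$ be a finite alphabet and $\sigma$ the left shift on $\mathcal{A}^{\mathbb{Z}}$ (product of discrete topologies). For a finite set $\mathcal{F}$ of finite words over $\mathcal{A}$, $X(\mathcal{F})$ is the set of $x\in\mathcal{A}^{\mathbb{Z}}$ in which no word of $\mathcal{F}$ appears; a shift of finite type (SFT) is a set $X$ of the form $X(\mathcal{F})$ with $\mathcal{F}$ finite. $B_n(X)$ is the set of words of length $n$ appearing in some $x\in X$. The entropy of $X$ is $\mathbf{h}(X)=\lim_n\frac1n\log|B_n(X)|$. Zeta function. With $N_p=|\{x\in X:\sigma^p(x)=x\}|$, $\zeta_X(t)=\exp\big(\sum_{p=1}^\infty \frac{N_p}{p}t^p\big)$, which converges for $0\le t<1/\lambda$ when $\mathbf{h}(X)=\log\lambda$. Random SFTs. $\Omega_n$ is the power set of $B_n(X)$. For $\alpha\in[0,1]$, $\mathbb{P}_\alpha$ is the probability measure on $\Omega_n$ obtained by including each word of $B_n(X)$ in the random subset $\omega$ independently with probability $\alpha$ (the dependence of $\mathbb{P}_\alpha$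 on $n$ is suppressed). To $\omega\in\Omega_n$ one associates the SFT $X_\omega$ of all $x\in X$ such that every word of length $n$ appearing in $x$ belongs to $\omega$. *)

(* Defs.v *)
From HB Require Import structures.
From mathcomp Require Import all_boot all_order all_algebra.
From mathcomp Require Import finmap.
From mathcomp Require Import all_classical all_reals all_analysis.

Set Implicit Arguments.
Unset Strict Implicit.
Unset Printing Implicit Defensive.

Import Order.TTheory GRing.Theory Num.Theory.
Import numFieldNormedType.Exports.

Local Open Scope classical_set_scope.
Local Open Scope ring_scope.

Definition config (A : finType) : Type := int -> A.

Section Shifts.
Variable A : finType.
Implicit Types (x : config A) (X : set (config A)).

Definition shift x : config A := fun i => x (i + 1).

Definition subword x (i : int) (n : nat) : seq A :=
  mkseq (fun k => x (i + k%:Z)) n.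

Definition appears (w : seq A) x : Prop :=
  exists i : int, subword x i (size w) = w.

Definition avoid (F : seq (seq A)) : set (config A) :=
  [set x | forall w, w \in F -> ~ appears w x].

Definition is_SFT X : Prop := exists F : seq (seq A), X = avoid F.

Definition lang X (n : nat) : {set n.-tuple A} :=
  [set w : n.-tuple A | `[< exists2 x, X x & appears w x >]].

Definition entropy (R : realType) X : R :=
  limn (fun n => n%:R^-1 * ln (#|lang X n|%:R : R)).

Definition periodic X (p : nat) : set (config A) :=
  [set x | X x /\ iter p shift x = x].

(* [fset_set] sends infinite sets to the empty set, but [periodic X p] is
   finite for 0 < p, since its elements are determined by p letters. *)
Definition nb_periodic X (p : nat) : nat := #|` fset_set (periodic X p)|%fset.

Definition zeta (R : realType) X (t : R) : R :=
  expR (\big[+%R/0]_(1 <= p <oo) ((nb_periodic X p)%:R / p%:R * t ^+ p)).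

Definition sub_SFT X (n : nat) (omega : {set n.-tuple A}) : set (config A) :=
  [set x | X x /\ forall w : n.-tuple A, appears w x -> w \in omega].

Definition empty_event X (n : nat) : {set {set n.-tuple A}} :=
  [set omega in powerset (lang X n) | `[< sub_SFT X omega = set0 >]].

End Shifts.

(* Law of the random subset of [B] that contains each element of [B]
   independently with probability [alpha]. *)
Definition bernoulli_subset_mass (R : realType) (T : finType) (alpha : R)
    (B omega : {set T}) : R :=
  \prod_(w in B) (if w \in omega then alpha else 1 - alpha).

Definition bernoulli_subset (R : realType) (T : finType) (alpha : R)
    (B : {set T}) (E : {set {set T}}) : R :=
  \sum_(omega in powerset B | omega \in E) bernoulli_subset_mass alpha B omega.

(* Main.v *)
(* For large n, the random SFT X_omega is nonempty iff omega contains the set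
   of n-words of some periodic point whose n-words within one period are
   distinct: a repetition of minimal length in a point of X_omega closes up to
   such a cycle.  Cycles of length at most M have disjoint sets of n-words, so
   none of them survives with probability prod (1 - alpha^length), a truncation
   of the Euler product of 1 / zeta; longer cycles contribute at most the tail
   of sum_p N_p alpha^p, which is small when alpha < 1 / lambda.

   For alpha >= 1 / lambda, comparing the same products at alpha and at
   b < 1 / lambda, it suffices that zeta b tends to infinity as b -> 1 / lambda.
   Let T be the transition matrix of a block presentation of X.  Then zeta is at
   least a constant multiple of 1 / det (1 - b T), by Jacobi's formula and
   tr (T^p) <= N_p, while det (1 - b T) * sum_n b^n T^n = adj (1 - b T) stays
   bounded and the entries of T^n add up to at least lambda^n. *)
Require Import Defs.
From HB Require Import structures.
From mathcomp Require Import all_boot all_order all_algebra.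
From mathcomp Require Import perm finmap ring lra zify.
From mathcomp Require Import all_classical all_reals all_analysis.

Set Implicit Arguments.
Unset Strict Implicit.
Unset Printing Implicit Defensive.

Import Order.TTheory GRing.Theory Num.Theory.
Import numFieldNormedType.Exports.

Local Open Scope classical_set_scope.
Local Open Scope ring_scope.

(** * Random subsets *)

Section BernoulliSubset.
Variables (R : realType) (T : finType) (alpha : R) (B : {set T}).
Implicit Types (C omega : {set T}) (E : {set {set T}}) (f g : {set T} -> R).

Definition bernoulli_mean f : R :=
  \sum_(omega in powerset B) bernoulli_subset_mass alpha B omega * f omega.

Lemma bernoulli_subsetE E :
  bernoulli_subset alpha B E = bernoulli_mean (fun omega => (omega \in E)%:R).
Proof.
rewrite /bernoulli_subset /bernoulli_mean big_mkcondr; apply: eq_bigr => w _.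
by case: (w \in E); rewrite ?mulr1 ?mulr0.
Qed.

Lemma bernoulli_mean_sum (I : Type) (r : seq I) (P : pred I)
    (F : I -> {set T} -> R) :
  bernoulli_mean (fun omega => \sum_(i <- r | P i) F i omega) =
  \sum_(i <- r | P i) bernoulli_mean (F i).
Proof.
by rewrite exchange_big; apply: eq_bigr => w _; rewrite mulr_sumr.
Qed.

Lemma bernoulli_meanZ c f :
  bernoulli_mean (fun omega => c * f omega) = c * bernoulli_mean f.
Proof. by rewrite mulr_sumr; apply: eq_bigr => w _; rewrite mulrCA. Qed.

Lemma bernoulli_meanB f g :
  bernoulli_mean (fun omega => f omega - g omega) =
  bernoulli_mean f - bernoulli_mean g.
Proof.
by rewrite -sumrB; apply: eq_bigr => w _; rewrite mulrBr.
Qed.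

Lemma bernoulli_mean_le f g : 0 <= alpha <= 1 ->
  (forall omega, omega \subset B -> f omega <= g omega) ->
  bernoulli_mean f <= bernoulli_mean g.
Proof.
move=> /andP[a0 a1] fg; apply: ler_sum => w; rewrite powersetE => wB.
apply: ler_wpM2l; last exact: fg.
by apply: prodr_ge0 => i _; case: ifP => _ //; rewrite subr_ge0.
Qed.

(** Expand the product of [F w + G w] over all words. [F] vanishes outside [B] and [G] vanishes on
    [C], so the surviving subsets are those between [C] and [B], each with its mass; and [F w + G w]
    is [alpha] on [C] and 1 elsewhere. *)
Lemma bernoulli_mean_subset C : C \subset B ->
  bernoulli_mean (fun omega => (C \subset omega)%:R) = alpha ^+ #|C|.
Proof.
move=> CB.
pose F w := if w \in B then alpha else 0.
pose G w := if w \in B then (if w \in C then 0 else 1 - alpha) else 1 : R.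
have -> : alpha ^+ #|C| = \prod_w (F w + G w).
  rewrite -prodr_const big_mkcond; apply: eq_bigr => w _; rewrite /F /G.
  have := fintype.subsetP CB w.
  case: (w \in C) => [->//|_]; first by rewrite addr0.
  by case: ifP => _; rewrite ?add0r // addrC subrK.
rewrite bigA_distr [RHS](bigID (fun w : {set T} => w \in powerset B)) /=.
rewrite [X in _ + X]big1 ?addr0 => [|w]; last first.
  rewrite powersetE => /subsetPn[x xw xB].
  by rewrite (bigD1 x) //= xw /F (negbTE xB) mul0r.
apply: eq_bigr => w; rewrite powersetE => wB.
have [Cw|/subsetPn[x xC xw]] := boolP (C \subset w).
  rewrite mulr1 /bernoulli_subset_mass big_mkcond; apply: eq_bigr => x _.
  rewrite /F /G; have := fintype.subsetP wB x; have := fintype.subsetP Cw x.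
  case: (x \in w) => [_ /(_ isT) -> //|].
  by case: (x \in C) => // /(_ isT).
rewrite mulr0 (bigD1 x) //= (negbTE xw) /G xC (fintype.subsetP CB) //.
by rewrite mul0r.
Qed.

(* Inclusion-exclusion: expanding the product of the [1 - [C \subset omega]]
   over subfamilies [S] of [F] gives terms [(-1)^#|S| alpha^#|cover S|], and
   disjointness makes [alpha ^ #|cover S|] multiplicative. *)
Lemma bernoulli_mean_no_subset (F : {set {set T}}) : finset.trivIset F ->
  (forall C, C \in F -> C \subset B) ->
  bernoulli_mean (fun omega => [forall C in F, ~~ (C \subset omega)]%:R) =
  \prod_(C in F) (1 - alpha ^+ #|C|).
Proof.
move=> tF FB.
have expand (h : {set T} -> R) : \prod_(C in F) (1 - h C) =
    \sum_(S : {set {set T}} | S \subset F) \prod_(C in S) (- h C).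
  have -> : \prod_(C in F) (1 - h C) =
      \prod_C ((if C \in F then - h C else 0) + 1).
    rewrite big_mkcond; apply: eq_bigr => C _.
    by case: ifP => _; rewrite ?add0r // addrC.
  rewrite bigA_distr (bigID (fun S : {set {set T}} => S \subset F)) /=.
  rewrite [X in _ + X]big1 ?addr0 => [|S /subsetPn[x xS xF]]; last first.
    by rewrite (bigD1 x) //= xS (negbTE xF) mul0r.
  apply: eq_bigr => S SF; rewrite [RHS]big_mkcond; apply: eq_bigr => C _.
  by case: ifP => // /(fintype.subsetP SF) ->.
transitivity (bernoulli_mean (fun omega =>
    \prod_(C in F) (1 - (C \subset omega)%:R))).
  congr (bernoulli_mean _); apply: boolp.funext => omega.
  have [/forall_inP H|] := boolP [forall C in F, ~~ (C \subset omega)].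
    by rewrite big1 // => C /H /negbTE ->; rewrite subr0.
  rewrite negb_forall => /existsP[C]; rewrite negb_imply negbK => /andP[CF Cw].
  by rewrite (bigD1 C) //= Cw subrr mul0r.
under [fun omega => _]boolp.funext => omega do rewrite expand.
rewrite bernoulli_mean_sum expand; apply: eq_bigr => S SF.
have SB : finset.cover S \subset B.
  by apply/bigcupsP => C CS; apply: FB; exact: (fintype.subsetP SF).
have tS : finset.trivIset S by apply: finset.trivIsetS tF.
transitivity (bernoulli_mean (fun omega =>
    (-1) ^+ #|S| * (finset.cover S \subset omega)%:R)).
  congr (bernoulli_mean _); apply: boolp.funext => omega.
  rewrite prodrN; congr (_ * _).
  have [/bigcupsP H|] := boolP (finset.cover S \subset omega).
    by rewrite big1 // => C /H ->.
  move=> /subsetPn[x /bigcupP[C CS xC] xw].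
  rewrite (bigD1 C) //=; case: (boolP (C \subset omega)); last by rewrite mul0r.
  by move=> /fintype.subsetP /(_ _ xC); rewrite (negbTE xw).
rewrite bernoulli_meanZ bernoulli_mean_subset // prodrN; congr (_ * _).
by rewrite -(eqP tS) expr_sum.
Qed.

End BernoulliSubset.

(** * Windows and periodic points *)

Section Windows.
Variable A : finType.
Implicit Types (x y z : config A) (X D : set (config A)).

Definition window x (i : int) n : n.-tuple A := [tuple x (i + (k : nat)%:Z) | k < n].

Lemma val_window x i n : val (window x i n) = subword x i n.
Proof.
apply: (@eq_from_nth _ (x i)); first by rewrite size_tuple size_mkseq.
move=> k; rewrite size_tuple => kn; rewrite nth_mkseq //.
by rewrite -(nth_mktuple (fun k : 'I_n => x (i + k%:Z)) (x i) (Ordinal kn)).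
Qed.

Lemma window_eqP x y i j n :
  window x i n = window y j n <->
  forall k, (k < n)%N -> x (i + k%:Z) = y (j + k%:Z).
Proof.
split=> [E k kn|H].
  by have := congr1 (fun t => tnth t (Ordinal kn)) E; rewrite !tnth_mktuple.
by apply: eq_from_tnth => k; rewrite !tnth_mktuple H.
Qed.

Lemma appears_tupleP n (w : n.-tuple A) x :
  appears w x <-> exists i, window x i n = w.
Proof.
split=> -[i E]; exists i; last by rewrite size_tuple -E val_window.
by apply: val_inj; rewrite val_window -[RHS]E size_tuple.
Qed.

Definition translate (j : int) x : config A := fun i => x (i + j).

Lemma iter_shift p x : iter p (@Defs.shift A) x = translate p%:Z x.
Proof.
apply: boolp.funext => i; elim: p i => [|p IH] i.
  by rewrite /translate addr0.
by rewrite iterS /Defs.shift IH /translate; congr x; lia.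
Qed.

Lemma iter_shift_eqP p x :
  iter p (@Defs.shift A) x = x <-> forall i, x (i + p%:Z) = x i.
Proof.
rewrite iter_shift; split=> [E i|H]; first by rewrite -[in RHS]E.
exact: boolp.funext.
Qed.

Lemma window_translate j x i n : window (translate j x) i n = window x (i + j) n.
Proof.
by apply/window_eqP => k _; rewrite /translate; congr x; lia.
Qed.

Lemma period_mul x p q : (forall i, x (i + p%:Z) = x i) ->
  forall i, x (i + (p * q)%:Z) = x i.
Proof.
move=> H i; elim: q => [|q IH]; first by rewrite muln0 addr0.
by rewrite mulnS addnC PoszD addrA H.
Qed.

Lemma period_mulz x p (q i : int) : (forall i, x (i + p%:Z) = x i) ->
  x (i + q * p%:Z) = x i.
Proof.
move=> H; case: q => q; first by rewrite mulrC -PoszM period_mul.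
rewrite -[LHS](period_mul q.+1 H); congr x; rewrite NegzE PoszM; ring.
Qed.

Lemma period_modz x p (i : int) : (forall i, x (i + p%:Z) = x i) ->
  x (i %% p%:Z)%Z = x i.
Proof.
move=> H; rewrite [in RHS](divz_eq i p%:Z) addrC.
by rewrite (period_mulz _ _ H).
Qed.

Lemma modz_natP (i : int) p : (0 < p)%N ->
  exists2 k, (k < p)%N & (i %% p%:Z)%Z = k%:Z.
Proof.
move=> p0; have p0' : p%:Z != 0 by lia.
have := modz_ge0 i p0'; have := ltz_pmod i (_ : 0 < p%:Z).
by case: (modz i p%:Z) => // k /(_ ltac:(lia)) kp _; exists k.
Qed.

Lemma period_eq x y p : (0 < p)%N ->
  (forall i, x (i + p%:Z) = x i) -> (forall i, y (i + p%:Z) = y i) ->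
  (forall k, (k < p)%N -> x k%:Z = y k%:Z) -> x = y.
Proof.
move=> p0 xp yp H; apply: boolp.funext => i.
rewrite -(period_modz _ xp) -(period_modz _ yp).
by have [k kp ->] := modz_natP i p0; exact: H.
Qed.

Lemma avoid_translate (F : seq (seq A)) j x : avoid F x -> avoid F (translate j x).
Proof.
move=> Fx w wF [i E]; apply: (Fx w wF); exists (i + j); rewrite -[RHS]E.
by apply: eq_map => k; rewrite /translate; congr x; lia.
Qed.

Lemma avoid_windows (F : seq (seq A)) m x y :
  (forall w, w \in F -> (size w <= m)%N) -> avoid F x ->
  (forall i, exists j, window y i m = window x j m) -> avoid F y.
Proof.
move=> Fm Fx H w wF [i E]; apply: (Fx w wF).
have [j /window_eqP yx] := H i; exists j; rewrite -[RHS]E.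
apply/eq_in_map => k; rewrite mem_iota add0n => /andP[_ kw].
by rewrite -yx // (leq_trans kw) // Fm.
Qed.

(** Sets of configurations may be infinite; words are counted through finite images of such sets, so
    that counting arguments become maps between configurations. *)
Definition img (T : finType) D (f : config A -> T) : {set T} :=
  [set t | `[< exists2 x, D x & f x = t >]].

Lemma mem_img (T : finType) D (f : config A -> T) t :
  (t \in img D f) <-> exists2 x, D x & f x = t.
Proof. by rewrite inE; split=> /boolp.asboolP. Qed.

Lemma img_f (T : finType) D (f : config A -> T) x : D x -> f x \in img D f.
Proof. by move=> Dx; apply/mem_img; exists x. Qed.

(** Choose a preimage [c t] of each value [t] of [f]; then [t] is recovered from [g (h (c t))]. *)
Lemma card_img_le (T T' : finType) D D' (h : config A -> config A)
    (f : config A -> T) (g : config A -> T') :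
  (forall x, D x -> D' (h x)) ->
  (forall x y, D x -> D y -> g (h x) = g (h y) -> f x = f y) ->
  (#|img D f| <= #|img D' g|)%N.
Proof.
move=> hD hfg.
have [[x0 Dx0]|noD] := boolp.pselect (exists x, D x); last first.
  suff -> : img D f = finset.set0 by rewrite cards0.
  by apply/setP => t; rewrite finset.in_set0; apply/negP => /mem_img[x Dx _]; apply: noD;
  exists x.
pose c t := xget x0 [set x | D x /\ f x = t].
have cP t : t \in img D f -> D (c t) /\ f (c t) = t.
  by move=> /mem_img[x Dx E]; rewrite /c; case: xgetP => [y _ []//|/(_ x)[]].
rewrite -(@card_in_imset _ _ (fun t => g (h (c t)))); last first.
  move=> t t' /cP[Dt ft] /cP[Dt' ft'] E; rewrite -ft -ft'; exact: hfg.
apply: subset_leq_card; apply/fintype.subsetP => _ /imsetP[t /cP[Dt _] ->].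
by apply: img_f; exact: hD.
Qed.

End Windows.

(** * Periodic points and their sets of words *)

Section PeriodicPoints.
Variable A : finType.
Implicit Types (x y : config A) (X : set (config A)) (F : seq (seq A)).

Definition windows n x : {set n.-tuple A} :=
  [set w | `[< exists i, window x i n = w >]].

Lemma windowsP n x w : (w \in windows n x) <-> exists i, window x i n = w.
Proof. by rewrite inE; split=> /boolp.asboolP. Qed.

Lemma mem_windows n x i : window x i n \in windows n x.
Proof. by apply/windowsP; exists i. Qed.

Lemma windows_translate n x j : windows n (translate j x) = windows n x.
Proof.
apply/setP => w; apply/idP/idP => /windowsP[i <-].
  by rewrite window_translate mem_windows.
by rewrite -[i](subrK j) -window_translate mem_windows.
Qed.

Lemma periodicP X p x :
  Defs.periodic X p x <-> X x /\ forall i, x (i + p%:Z) = x i.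
Proof. by split=> -[Xx /iter_shift_eqP]. Qed.

Lemma periodic_translate F p x j :
  Defs.periodic (avoid F) p x -> Defs.periodic (avoid F) p (translate j x).
Proof.
move=> /periodicP[Fx xp]; apply/periodicP; split; first exact: avoid_translate.
by move=> i; rewrite /translate addrAC xp.
Qed.

Section Closing.
Variables (F : seq (seq A)) (n : nat) (x : config A) (i : int) (p : nat).
Hypotheses (Fn : forall w, w \in F -> (size w <= n)%N) (Fx : avoid F x).
Hypotheses (p_gt0 : (0 < p)%N).
Hypothesis repeat_ip : window x i n = window x (i + p%:Z) n.

Definition closing : config A := fun k => x (i + (k %% p%:Z)%Z).

Lemma closing_period k : closing (k + p%:Z) = closing k.
Proof. by rewrite /closing modzDr. Qed.

(** Beyond the first [p] letters, periodicity of [closing] and the repetition in [x] both lower [a]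
    by [p]. *)
Lemma closing_nat a : (a < p + n)%N -> closing a%:Z = x (i + a%:Z).
Proof.
elim/ltn_ind: a => a IH apn; have [ap|pa] := ltnP a p.
  by rewrite /closing modz_small //; lia.
have -> : a%:Z = (a - p)%N%:Z + p%:Z by lia.
rewrite closing_period IH; [|lia|lia].
move/window_eqP: repeat_ip => ->; last by lia.
by congr x; lia.
Qed.

(** Modulo the period a window starts before [p], and then lies within the [p + n] letters that
    [closing] shares with [x]. *)
Lemma window_closing k : exists2 j, (j < p)%N &
  window closing k n = window x (i + j%:Z) n.
Proof.
have [j jp E] := modz_natP k p_gt0; exists j => //.
apply/window_eqP => l ln; rewrite (divz_eq k p%:Z) E.
have -> : (k %/ p%:Z)%Z * p%:Z + j%:Z + l%:Z =
   (j + l)%N%:Z + (k %/ p%:Z)%Z * p%:Z by lia.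
rewrite (period_mulz _ _ closing_period) closing_nat; last by lia.
by congr x; lia.
Qed.

Lemma avoid_closing : avoid F closing.
Proof.
apply: (avoid_windows Fn Fx) => k; have [j _ ->] := window_closing k.
by eexists.
Qed.

Lemma periodic_closing : Defs.periodic (avoid F) p closing.
Proof.
by apply/periodicP; split; [exact: avoid_closing|exact: closing_period].
Qed.

Lemma windows_closing :
  windows n closing = [set window x (i + (j : nat)%:Z) n | j : 'I_p].
Proof.
apply/setP => w; apply/idP/idP => [/windowsP[k <-]|].
  have [j jp ->] := window_closing k.
  by apply/imsetP; exists (Ordinal jp).
move=> /imsetP[j _ ->]; apply/windowsP; exists (j : nat)%:Z.
apply/window_eqP => l ln; rewrite -PoszD closing_nat ?PoszD ?addrA //.
by have := ltn_ord j; lia.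
Qed.

End Closing.

(* A repetition [window x i n = window x (i + p) n] with [p] minimal closes up
   to a cycle visiting [p] distinct words. *)
Lemma exists_simple_cycle F n x :
  (forall w, w \in F -> (size w <= n)%N) -> avoid F x ->
  exists p y, [/\ (0 < p)%N, Defs.periodic (avoid F) p y,
    #|windows n y| = p & windows n y \subset windows n x].
Proof.
move=> Fn Fx.
pose P p := (0 < p)%N &&
  `[< exists i : int, window x i n = window x (i + p%:Z) n >].
(* Pigeonhole: with more positions than words of length [n], two positions carry the same word. *)
have exP : exists p, P p.
  pose f (k : 'I_(#|{: n.-tuple A}|.+1)) := window x (k : nat)%:Z n.
  have : ~~ injectiveb f.
    apply/negP => /injectiveP /leq_card; rewrite card_ord.
    by rewrite ltnn.
  have ltP (k l : 'I_(#|{: n.-tuple A}|.+1)) : (k < l)%N -> f k = f l ->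
      exists p, P p.
    move=> kl fkl; exists (l - k)%N; rewrite /P subn_gt0 kl /=.
    apply/boolp.asboolP; exists (k : nat)%:Z; rewrite -PoszD subnKC 1?ltnW //.
  move=> /injectivePn[k [l kl fkl]].
  have [lt|lt|E] := ltngtP k l; [exact: (ltP k l)|exact: (ltP l k)|].
  by move/val_inj: E kl => ->; rewrite eqxx.
have := ex_minnP exP; case=> p /andP[p0 /boolp.asboolP[i rep]] pmin.
exists p, (closing x i p); split => //.
- exact: periodic_closing rep.
- rewrite (windows_closing p0 rep) card_imset ?card_ord //.
  (* Equal windows at [j < k < p] would be a repetition at the smaller distance [k - j]. *)
  have ltW (j k : 'I_p) : (j < k)%N ->
      window x (i + (j : nat)%:Z) n = window x (i + (k : nat)%:Z) n -> False.
    move=> jk E; have : P (k - j)%N.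
      rewrite /P subn_gt0 jk /=; apply/boolp.asboolP.
      exists (i + (j : nat)%:Z); rewrite E; congr (window x _ n); lia.
    by move=> /pmin; have := ltn_ord k; lia.
  move=> j k E; apply: val_inj => /=.
  by case: (ltngtP j k) => // [/ltW /(_ E)|/ltW /(_ (esym E))].
- rewrite (windows_closing p0 rep); apply/fintype.subsetP => w /imsetP[j _ ->].
  exact: mem_windows.
Qed.

(** The cardinal is the least period [d] of [x]: the periods are the multiples of [d], and since
    [d <= n] a window covers a full period, so that equal windows at distance less than [d] would
    yield a smaller period. *)
Lemma card_windows n p x : (0 < p <= n)%N -> (forall i, x (i + p%:Z) = x i) ->
  (0 < #|windows n x|)%N /\
  forall q, (forall i, x (i + q%:Z) = x i) <-> (#|windows n x| %| q)%N.
Proof.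
move=> /andP[p0 pn] xp.
pose P q := (0 < q)%N && `[< forall i, x (i + q%:Z) = x i >].
have exP : exists q, P q by exists p; rewrite /P p0; exact/boolp.asboolP.
have := ex_minnP exP; case=> d /andP[d0 /boolp.asboolP xd] dmin.
have dP q : (forall i, x (i + q%:Z) = x i) <-> (d %| q)%N.
  split=> [xq|/dvdnP[k ->] i]; last by rewrite mulnC period_mul.
  rewrite /dvdn; have [//|r0] := posnP (q %% d).
  suff /dmin : P (q %% d)%N by have := ltn_pmod q d0; lia.
  rewrite /P r0; apply/boolp.asboolP => i.
  rewrite -[RHS]xq [in RHS](divn_eq q d) PoszD PoszM.
  rewrite addrCA (addrC (_ * _)) (period_mulz _ _ xd); congr x; lia.
have dn : (d <= n)%N.
  by apply: leq_trans pn; apply: dmin; rewrite /P p0; exact/boolp.asboolP.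
suff -> : #|windows n x| = d by [].
have -> : windows n x = [set window x (j : nat)%:Z n | j : 'I_d].
  apply/setP => w; apply/idP/idP => [/windowsP[k <-]|/imsetP[j _ ->]]; last first.
    exact: mem_windows.
  have [j jd E] := modz_natP k d0; apply/imsetP; exists (Ordinal jd) => //=.
  apply/window_eqP => l _; rewrite (divz_eq k d%:Z) E.
  by rewrite -addrA addrC (period_mulz _ _ xd).
rewrite card_imset ?card_ord //.
have ltW (j k : 'I_d) : (j < k)%N ->
    window x (j : nat)%:Z n = window x (k : nat)%:Z n -> False.
  move=> jk /window_eqP E; have : P (k - j)%N.
    rewrite /P subn_gt0 jk /=; apply/boolp.asboolP.
    suff H : translate (k : nat)%:Z x = translate (j : nat)%:Z x.
      move=> i; have := congr1 (fun y => y (i - (j : nat)%:Z)) H.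
      by rewrite /translate subrK => <-; congr x; lia.
    apply: (period_eq d0) => [i|i|a ad]; rewrite /translate.
    + by rewrite addrAC xd.
    + by rewrite addrAC xd.
    + by rewrite addrC -E 1?addrC // (leq_trans ad dn).
  by move=> /dmin; have := ltn_ord k; lia.
move=> j k E; apply: val_inj => /=.
by case: (ltngtP j k) => // [/ltW /(_ E)|/ltW /(_ (esym E))].
Qed.

End PeriodicPoints.

(** * Short cycles and the counting of periodic points *)

Section ShortCycles.
Variables (A : finType) (F : seq (seq A)).
Notation X := (avoid F).

(** A cycle is recorded by its set of words, which is invariant under translation: an orbit
    contributes a single element, whose cardinal is the least period once [M <= n]. *)
Definition short_cycles M n : {set {set n.-tuple A}} :=
  [set C | `[< exists p x, [/\ (0 < p <= M)%N, Defs.periodic X p x &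
                               windows n x = C] >]].

Lemma short_cyclesP M n C : (C \in short_cycles M n) <->
  exists p x, [/\ (0 < p <= M)%N, Defs.periodic X p x & windows n x = C].
Proof. by rewrite inE; split=> /boolp.asboolP. Qed.

(** If points of periods [p, q <= M] share a word of length [n >= p * q], suitable translates agree
    on a full common period [p * q], hence everywhere. *)
Lemma short_cycles_trivIset M n : (M * M <= n)%N ->
  finset.trivIset (short_cycles M n).
Proof.
move=> Mn; apply/finset.trivIsetP => C D.
move=> /short_cyclesP[p [x [/andP[p0 pM] /periodicP[_ xp] <-]]].
move=> /short_cyclesP[q [y [/andP[q0 qM] /periodicP[_ yq] <-]]].
apply: contraR; rewrite -setI_eq0 => /set0Pn[w].
rewrite finset.in_setI => /andP[/windowsP[i <-] /windowsP[j /window_eqP E]].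
rewrite -(windows_translate _ x i) -(windows_translate _ y j).
suff -> : translate i x = translate j y by [].
apply: (@period_eq _ _ _ (p * q)); rewrite ?muln_gt0 ?p0 //.
- by move=> k; rewrite /translate addrAC period_mul.
- by move=> k; rewrite /translate addrAC mulnC period_mul.
- move=> k kpq; rewrite /translate ![k%:Z + _]addrC E //.
  by apply: leq_trans kpq _; apply: leq_trans Mn; exact: leq_mul.
Qed.

Lemma short_cycles_sub M n C : C \in short_cycles M n -> C \subset lang X n.
Proof.
move=> /short_cyclesP[p [x [_ /periodicP[Xx _] <-]]].
apply/fintype.subsetP => w /windowsP[i E]; rewrite inE; apply/boolp.asboolP.
by exists x => //; apply/appears_tupleP; exists i.
Qed.

Lemma short_cycles_card M n C : (M * M <= n)%N -> C \in short_cycles M n ->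
  (0 < #|C|)%N.
Proof.
move=> MMn; have Mn : (M <= n)%N.
  by case: M MMn => // M' H; apply: leq_trans H; rewrite leq_pmull.
move=> /short_cyclesP[p [x [/andP[p0 pM] /periodicP[_ xp] <-]]].
by have [] := @card_windows _ n p x _ xp; rewrite // p0 (leq_trans pM).
Qed.

(** A point of period [p] is determined by [p] consecutive letters, so [periodic X p] is in
    bijection with a finite set of words. *)
Lemma nb_periodicE p : (0 < p)%N ->
  nb_periodic X p = #|img (Defs.periodic X p) (fun x => window x 0 p)|.
Proof.
move=> p0; rewrite /nb_periodic.
set P := Defs.periodic X p.
have inj : set_inj P (fun x => window x 0 p).
  move=> x y /set_mem /periodicP[_ xp] /set_mem /periodicP[_ yp] /window_eqP E.
  by apply: (period_eq p0) => // k kp; have := E k kp; rewrite !add0r.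
have img_eq : (fun x => window x 0 p) @` P =
    [set` img P (fun x => window x 0 p)].
  apply/seteqP; split=> w /=; first by move=> [x Px <-]; exact: img_f.
  by move=> /mem_img[x Px <-]; exists x.
apply: card_fset_set; apply: card_eq_trans (card_esym (inj_card_eq inj)) _.
rewrite img_eq; set I := img _ _.
have -> : [set` I] = [set` [fset w in I]%fset].
  by apply/seteqP; split=> w /=; rewrite !inE.
by apply/card_eq_fsetP; rewrite card_finset.
Qed.

Section Counting.
Variables (M n : nat).
Hypothesis MMn : (M * M <= n)%N.

Let Mn : (M <= n)%N.
Proof. by case: M MMn => // M' H; apply: leq_trans H; rewrite leq_pmull. Qed.

Lemma short_cycles_windows p t : (0 < p)%N ->
  t \in finset.cover [set C in short_cycles M n | (#|C| %| p)%N] ->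
  t \in img (Defs.periodic X p) (fun x => window x 0 n).
Proof.
move=> p0 /bigcupP[C]; rewrite inE => /andP[].
move=> /short_cyclesP[q [x [/andP[q0 qM] Px <-]]].
have [Xx xq] := (periodicP _ _ _).1 Px.
have [_ H] := @card_windows _ n q x (ltac:(by rewrite q0 (leq_trans qM))) xq.
move=> /H xp /windowsP[i <-].
apply/mem_img; exists (translate i x); last by rewrite window_translate add0r.
exact/periodic_translate/periodicP.
Qed.

(** By disjointness the sum is the number of words in the union of these cycles. Each such word is
    the window at 0 of a point of period [p], and that point determines it, whether or not [p]
    exceeds [n]. *)
Lemma sum_short_cycles_le p : (0 < p)%N ->
  (\sum_(C in short_cycles M n | #|C| %| p) #|C| <= nb_periodic X p)%N.
Proof.
move=> p0; rewrite nb_periodicE //.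
have -> : (\sum_(C in short_cycles M n | #|C| %| p) #|C| =
    #|finset.cover [set C in short_cycles M n | (#|C| %| p)%N]|)%N.
  have /eqP <- : finset.trivIset [set C in short_cycles M n | (#|C| %| p)%N].
    apply: finset.trivIsetS (short_cycles_trivIset MMn).
    by apply/fintype.subsetP => C; rewrite inE => /andP[].
  by apply: eq_bigl => C; rewrite [RHS]inE.
apply: (@leq_trans #|img (Defs.periodic X p) (fun x => window x 0 n)|).
  apply/subset_leq_card/fintype.subsetP => t; exact: short_cycles_windows.
apply: (card_img_le (h := id)) => // x y /periodicP[_ xp] /periodicP[_ yp].
move=> /window_eqP E; suff -> : x = y by [].
by apply: (period_eq p0) => // k kp; have := E k kp; rewrite !add0r.
Qed.

(** For [p <= M] no cycle is missed: every point of period [p] lies on a short cycle, and its [n]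
    letters from 0 on determine its first [p] letters. *)
Lemma nb_periodic_le_sum p : (0 < p <= M)%N ->
  (nb_periodic X p <= \sum_(C in short_cycles M n | #|C| %| p) #|C|)%N.
Proof.
move=> /andP[p0 pM]; rewrite nb_periodicE //.
have pn : (p <= n)%N := leq_trans pM Mn.
apply: (@leq_trans #|img (Defs.periodic X p) (fun x => window x 0 n)|).
  apply: (card_img_le (h := id)) => // x y _ _ /window_eqP E.
  by apply/window_eqP => k kp; apply: E; exact: leq_trans pn.
apply: (@leq_trans #|finset.cover [set C in short_cycles M n | (#|C| %| p)%N]|).
  apply/subset_leq_card/fintype.subsetP => t /mem_img[x Px <-].
  have [Xx xp] := (periodicP _ _ _).1 Px.
  have [_ H] := @card_windows _ n p x (ltac:(by rewrite p0 pn)) xp.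
  apply/bigcupP; exists (windows n x); last exact: mem_windows.
  rewrite inE; apply/andP; split; last exact/H.
  by apply/short_cyclesP; exists p, x; rewrite p0 pM.
apply: leq_trans (leq_card_cover _) _; rewrite (eq_bigl (fun C =>
  (C \in short_cycles M n) && (#|C| %| p)%N)) // => C.
by rewrite [LHS]inE.
Qed.

End Counting.

End ShortCycles.

(** * The probability of emptiness *)

Section EmptinessProbability.
Variables (R : realType) (A : finType) (F : seq (seq A)) (alpha : R) (M n : nat).
Hypotheses (alpha01 : 0 <= alpha <= 1) (MMn : (M * M <= n)%N).
Notation X := (avoid F).
Notation prob_empty := (bernoulli_subset alpha (lang X n) (empty_event X n)).

Lemma sub_SFT_periodic (omega : {set n.-tuple A}) p x :
  Defs.periodic X p x -> windows n x \subset omega -> sub_SFT X omega x.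
Proof.
move=> /periodicP[Xx _] /fintype.subsetP xo; split=> // w /appears_tupleP[i <-].
exact/xo/mem_windows.
Qed.

(** A cycle contained in [omega] comes from a periodic point of the random SFT; hence emptiness
    forces [omega] to contain no short cycle. *)
Lemma prob_empty_le : prob_empty <= \prod_(C in short_cycles F M n) (1 - alpha ^+ #|C|).
Proof.
rewrite -(@bernoulli_mean_no_subset R _ alpha (lang X n)); first last.
- exact: short_cycles_sub.
- exact: short_cycles_trivIset.
rewrite bernoulli_subsetE; apply: bernoulli_mean_le => // omega _.
have [|_] := boolP (omega \in _); last by rewrite ler0n.
rewrite inE => /andP[_ /boolp.asboolP E].
rewrite ler_nat lt0b; apply/forall_inP => C.
move=> /short_cyclesP[p [x [_ Px <-]]]; apply/negP => /(sub_SFT_periodic Px).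
by rewrite E.
Qed.

Hypothesis Fn : forall w, w \in F -> (size w <= n)%N.

(** If no short cycle lies in [omega] and the random SFT is nonempty, then [omega] contains a cycle
    of exactly [p > M] words. The subtracted sum is a union bound over these cycles; [p] is at most
    the number of words of length [n]. *)
Lemma prob_empty_ge :
  \prod_(C in short_cycles F M n) (1 - alpha ^+ #|C|) -
  \sum_(M.+1 <= p < #|{: n.-tuple A}|.+1) (nb_periodic X p)%:R * alpha ^+ p
  <= prob_empty.
Proof.
have a0 : 0 <= alpha by case/andP: alpha01.
pose G p : {set {set n.-tuple A}} := img (Defs.periodic X p) (windows n).
have GX p C : C \in G p -> C \subset lang X n.
  move=> /mem_img[x /periodicP[Xx _] <-].
  apply/fintype.subsetP => w /windowsP[i E]; rewrite inE; apply/boolp.asboolP.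
  by exists x => //; apply/appears_tupleP; exists i.
apply: (@le_trans _ _ (
  \prod_(C in short_cycles F M n) (1 - alpha ^+ #|C|) -
  \sum_(M.+1 <= p < #|{: n.-tuple A}|.+1) \sum_(C in G p | #|C| == p)
     alpha ^+ #|C|)).
  rewrite lerD2l lerN2 big_nat [leRHS]big_nat; apply: ler_sum => p /andP[Mp _].
  have p0 : (0 < p)%N by apply: leq_trans Mp.
  apply: (@le_trans _ _ (\sum_(C in G p) alpha ^+ p)).
    rewrite big_mkcondr; apply: ler_sum => C _.
    by case: eqP => [->//|_]; rewrite exprn_ge0.
  rewrite sumr_const -[leLHS]mulr_natl ler_wpM2r ?exprn_ge0 // ler_nat nb_periodicE //.
  apply: (card_img_le (h := id)) => // x y /periodicP[_ xp] /periodicP[_ yp].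
  move=> /window_eqP E; suff -> : x = y by [].
  by apply: (period_eq p0) => // k kp; have := E k kp; rewrite !add0r.
rewrite -(@bernoulli_mean_no_subset R _ alpha (lang X n)); first last.
- exact: short_cycles_sub.
- exact: short_cycles_trivIset.
have -> : \sum_(M.+1 <= p < #|{: n.-tuple A}|.+1) \sum_(C in G p | #|C| == p)
     alpha ^+ #|C| = bernoulli_mean alpha (lang X n) (fun omega =>
  \sum_(M.+1 <= p < #|{: n.-tuple A}|.+1) \sum_(C in G p | #|C| == p)
     (C \subset omega)%:R).
  rewrite bernoulli_mean_sum; apply: eq_bigr => p _.
  rewrite bernoulli_mean_sum; apply: eq_bigr => C /andP[/GX CX _].
  by rewrite bernoulli_mean_subset.
rewrite -bernoulli_meanB bernoulli_subsetE; apply: bernoulli_mean_le => // omega oX.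
have S0 p : 0 <= \sum_(C in G p | #|C| == p) (C \subset omega)%:R :> R.
  by apply: sumr_ge0.
(* Only the indicators remain to be compared: for [omega] outside the event, either a short cycle
   lies in [omega] or some term of the sum equals 1. *)
have [_|oE] := boolP (omega \in _).
  rewrite lerBlDr -[leLHS]addr0 lerD ?lern1 ?leq_b1 //.
  by apply: sumr_ge0.
rewrite lerBlDr add0r.
case: (boolP [forall C in short_cycles F M n, ~~ (C \subset omega)]) =>
  [/forall_inP short|_]; last exact: sumr_ge0.
have [x [Xx xo]] : exists x, sub_SFT X omega x.
  apply: boolp.contrapT => H; move/negP: oE; apply; rewrite inE powersetE oX /=.
  by apply/boolp.asboolP/seteqP; split=> x // Hx; apply: H; exists x.
have {xo} xo : windows n x \subset omega.
  apply/fintype.subsetP => w /windowsP[i E]; apply: xo.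
  by apply/appears_tupleP; exists i.
have [p [y [p0 yp yn yx]]] := exists_simple_cycle Fn Xx.
have yo := fintype.subset_trans yx xo.
have Mp : (M < p)%N.
  rewrite ltnNge; apply/negP => pM.
  have /short : windows n y \in short_cycles F M n.
    by apply/short_cyclesP; exists p, y; rewrite p0 pM.
  by rewrite yo.
have pK : (p < #|{: n.-tuple A}|.+1)%N by rewrite ltnS -yn max_card.
rewrite (bigD1_seq p) ?iota_uniq ?mem_index_iota ?Mp //=.
rewrite (bigD1 (windows n y)) /=; last by rewrite yn eqxx andbT; exact: img_f.
rewrite yo -addrA lerDl addr_ge0 //; first by apply: sumr_ge0.
by apply: sumr_ge0.
Qed.

End EmptinessProbability.

(** * Euler product *)

Section PolynomialTimesExponential.
Variable R : realType.
Implicit Types (p q : {poly R}) (a : nat -> R).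

(** Mean value theorem for [p e^q], whose derivative is [(p' + p q') e^q]. It is applied with [q] a
    truncated logarithm of [1 / p], which makes [p' + p q'] small or nonnegative. *)
Lemma mul_expR_lower_bound p q (b c : R) : 0 <= b ->
  (forall x, 0 <= x <= b -> - c <= (p^`() + p * q^`()).[x] * expR q.[x]) ->
  p.[0] * expR q.[0] - c * b <= p.[b] * expR q.[b].
Proof.
move=> b0 H.
pose f := (horner p : R -> R) * (expR \o horner q).
have df (x : R) : is_derive x (1 : R) f ((p^`() + p * q^`()).[x] * expR q.[x]).
  apply: trigger_derive; rewrite /= !hornerE /GRing.scale /=; ring.
have [x xb E] : exists2 x, x \in `[0, b] &
    f b - f 0 = (p^`() + p * q^`()).[x] * expR q.[x] * (b - 0).
  apply: MVT_segment => //.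
  apply: continuous_subspaceT => x; apply: differentiable_continuous.
  exact/derivable1_diffP/(@ex_derive _ _ _ _ _ _ _ (df x)).
have -> : p.[b] * expR q.[b] = f b by [].
have -> : p.[0] * expR q.[0] = f 0 by [].
rewrite in_itv /= in xb; have := ler_wpM2r b0 (H x xb).
by rewrite subr0 in E; rewrite -E; lra.
Qed.

(** Truncation of [- log (1 - x)] for [a k = 1], and of [- log det (1 - x T)] for
    [a k = tr (T^k)]. *)
Definition exp_series_poly a K : {poly R} :=
  \sum_(1 <= k < K.+1) (a k / k%:R) *: 'X^k.

Lemma horner_exp_series_poly a K x :
  (exp_series_poly a K).[x] = \sum_(1 <= k < K.+1) a k / k%:R * x ^+ k.
Proof. by rewrite horner_sum; apply: eq_bigr => k _; rewrite !hornerE. Qed.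

Lemma horner0_exp_series_poly a K : (exp_series_poly a K).[0] = 0.
Proof.
rewrite horner_exp_series_poly big_nat big1 // => k /andP[k0 _].
by rewrite expr0n eqn0Ngt k0 mulr0.
Qed.

Lemma deriv_exp_series_poly a K x :
  (exp_series_poly a K)^`().[x] = \sum_(k < K) a k.+1 * x ^+ k.
Proof.
rewrite /exp_series_poly big_add1 /= big_mkord raddf_sum horner_sum.
apply: eq_bigr => k _; rewrite /= derivZ derivXn hornerZ hornerMn hornerXn /=.
by rewrite mulrnAr -mulrnAl -[X in X * _]mulr_natr divfK // pnatr_eq0.
Qed.

Lemma geometric_sum (x : R) K : (1 - x) * \sum_(k < K) x ^+ k = 1 - x ^+ K.
Proof. by rewrite -(opprB x) mulNr -subrX1 opprB. Qed.

(** With [q] the truncated series, [(y - 1) e^q] has derivative [y^K e^q >= 0] and value -1 at 0. *)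
Lemma le_expR_log_series (x : R) K : 0 <= x <= 1 ->
  1 - x <= expR (- \sum_(1 <= k < K.+1) x ^+ k / k%:R).
Proof.
move=> /andP[x0 x1].
have := @mul_expR_lower_bound ('X - 1) (exp_series_poly (fun=> 1) K) x 0 x0.
rewrite !hornerE /= horner0_exp_series_poly expR0 horner_exp_series_poly => H.
have {}H := H _; rewrite expRN.
have -> : \sum_(1 <= k < K.+1) x ^+ k / k%:R =
    \sum_(1 <= k < K.+1) 1 / k%:R * x ^+ k.
  by apply: eq_bigr => k _; rewrite mul1r mulrC.
rewrite -[leRHS]mul1r ler_pdivlMr ?expR_gt0 // -lerN2 -mulNr opprB.
suff H1 : forall y, 0 <= y <= x -> - 0 <= (('X - 1 : {poly R})^`() +
  ('X - 1) * (exp_series_poly (fun=> 1) K)^`()).[y] *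
  expR (exp_series_poly (fun=> 1) K).[y] by have := H H1; lra.
move=> y /andP[y0 yx]; rewrite oppr0 mulr_ge0 ?expR_ge0 //.
rewrite !(derivB, derivX, derivC, hornerE) deriv_exp_series_poly /=.
under eq_bigr do rewrite mul1r.
by have := geometric_sum y K; have := exprn_ge0 K y0; lra.
Qed.

(** The added term makes [(1 - y) e^q] nondecreasing on [[0, x]]: its contribution
    [(1 - y) (K + 1) y^K / (1 - x)] outweighs the defect [- y^K]. Its denominator is frozen at [x]
    to keep [q] polynomial. *)
Lemma ge_expR_log_series (x : R) K : 0 <= x < 1 ->
  expR (- (\sum_(1 <= k < K.+1) x ^+ k / k%:R + x ^+ K.+1 / (1 - x))) <= 1 - x.
Proof.
move=> /andP[x0 x1].
pose q := exp_series_poly (fun=> 1) K + (1 - x)^-1 *: 'X^(K.+1).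
have qE y : q.[y] = \sum_(1 <= k < K.+1) y ^+ k / k%:R + y ^+ K.+1 / (1 - x).
  rewrite hornerD horner_exp_series_poly !hornerE mulrC; congr (_ + _).
  by apply: eq_bigr => k _; rewrite mul1r mulrC.
rewrite expRN -qE -[leLHS]mul1r ler_pdivrMr ?expR_gt0 //.
have x1' : 0 < 1 - x by rewrite subr_gt0.
have := @mul_expR_lower_bound (1 - 'X) q x 0 x0.
rewrite !hornerE /= horner0_exp_series_poly expr0n /= !mulr0 addr0 expR0.
rewrite !subr0 mulr1; apply => y /andP[y0 yx].
rewrite oppr0 mulr_ge0 ?expR_ge0 //.
rewrite !(derivB, derivX, derivC, hornerE) /= /q derivD derivZ derivXn hornerD.
rewrite deriv_exp_series_poly hornerZ hornerMn hornerXn.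
under eq_bigr do rewrite mul1r.
rewrite mulrDr geometric_sum /=.
suff : y ^+ K <= (1 - y) * ((1 - x)^-1 * y ^+ K *+ K.+1) by lra.
rewrite -mulrnAr mulrA; apply: (@le_trans _ _ (1 * (y ^+ K *+ K.+1))).
  by rewrite mul1r mulrS lerDl mulrn_wge0 // exprn_ge0.
rewrite ler_wpM2r ?mulrn_wge0 ?exprn_ge0 // ler_pdivlMr // mul1r.
lra.
Qed.

End PolynomialTimesExponential.

Lemma sum_dvdn (V : nmodType) (f : nat -> V) c L : (0 < c)%N ->
  \sum_(1 <= p < L.+1 | (c %| p)%N) f (p %/ c)%N =
  \sum_(1 <= k < (L %/ c).+1) f k.
Proof.
move=> c0; elim: L => [|L IH]; first by rewrite div0n !big_nil.
rewrite big_mkcond big_nat_recr //= -big_mkcond IH divnS //.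
by case: (c %| L.+1)%N; rewrite ?addr0 // [RHS]big_nat_recr.
Qed.

(** * The product over short cycles against the zeta function *)

Section ShortCyclesProduct.
Variables (R : realType) (A : finType) (F : seq (seq A)) (M n : nat).
Hypothesis MMn : (M * M <= n)%N.
Notation X := (avoid F).

Definition zeta_partial (t : R) K : R :=
  \sum_(1 <= p < K.+1) (nb_periodic X p)%:R / p%:R * t ^+ p.

(** Substitute [p = k #|C|], so that [1 / k = #|C| / p], and exchange the sums. Cutting each series
    at [L %/ #|C|] amounts to [p <= L]. *)
Lemma log_series_short_cycles (t : R) L :
  \sum_(C in short_cycles F M n) \sum_(1 <= k < (L %/ #|C|).+1)
      (t ^+ #|C|) ^+ k / k%:R =
  \sum_(1 <= p < L.+1)
     (\sum_(C in short_cycles F M n | (#|C| %| p)%N) #|C|)%N%:R / p%:R * t ^+ p.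
Proof.
transitivity (\sum_(C in short_cycles F M n)
    \sum_(1 <= p < L.+1 | (#|C| %| p)%N) #|C|%:R / p%:R * t ^+ p).
  apply: eq_bigr => C /(short_cycles_card MMn) C0.
  rewrite -sum_dvdn // big_nat_cond [RHS]big_nat_cond.
  apply: eq_bigr => p /andP[/andP[p0 _] Cp].
  rewrite -exprM mulnC divnK // mulrC; congr (_ * _).
  rewrite -[in RHS](divnK Cp) natrM invfM mulrCA mulfV ?mulr1 //.
  by rewrite pnatr_eq0 -lt0n.
rewrite (exchange_big_dep xpredT) //=; apply: eq_bigr => p _.
by rewrite natr_sum !mulr_suml; apply: eq_bigl => C; rewrite andbC.
Qed.

Lemma prod_short_cycles_le (t : R) : 0 <= t <= 1 ->
  \prod_(C in short_cycles F M n) (1 - t ^+ #|C|) <= expR (- zeta_partial t M).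
Proof.
move=> /andP[t0 t1].
have tC C : 0 <= t ^+ #|C : {set n.-tuple A}| <= 1.
  by rewrite exprn_ge0 // exprn_ile1.
apply: (@le_trans _ _ (\prod_(C in short_cycles F M n)
  expR (- \sum_(1 <= k < (M %/ #|C|).+1) (t ^+ #|C|) ^+ k / k%:R))).
  apply: ler_prod => C _; have /andP[_ tC1] := tC C.
  by rewrite subr_ge0 tC1 le_expR_log_series.
rewrite -expR_sum ler_expR sumrN lerN2 log_series_short_cycles.
rewrite /zeta_partial big_nat [leRHS]big_nat; apply: ler_sum => p /andP[p0 pM].
rewrite ler_wpM2r ?exprn_ge0 // ler_wpM2r ?invr_ge0 // ler_nat.
by rewrite nb_periodic_le_sum // p0.
Qed.

(** Cutting the logarithms at exponent [L] costs at most [t^L / (1 - t)] per cycle. The number of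
    cycles is fixed, so the cost vanishes as [L] grows. *)
Lemma prod_short_cycles_ge (t S : R) : 0 <= t < 1 ->
  (forall K, zeta_partial t K <= S) ->
  expR (- S) <= \prod_(C in short_cycles F M n) (1 - t ^+ #|C|).
Proof.
move=> /andP[t0 t1] HS.
have bound L : expR (- (S + #|short_cycles F M n|%:R * (t ^+ L / (1 - t)))) <=
    \prod_(C in short_cycles F M n) (1 - t ^+ #|C|).
  apply: (@le_trans _ _ (\prod_(C in short_cycles F M n)
    expR (- (\sum_(1 <= k < (L %/ #|C|).+1) (t ^+ #|C|) ^+ k / k%:R +
             (t ^+ #|C|) ^+ (L %/ #|C|).+1 / (1 - t ^+ #|C|))))).
    rewrite -expR_sum ler_expR sumrN lerN2 big_split /=; apply: lerD.
      apply: le_trans (HS L); rewrite log_series_short_cycles.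
      rewrite /zeta_partial big_nat [leRHS]big_nat.
      apply: ler_sum => p /andP[p0 pM].
      rewrite ler_wpM2r ?exprn_ge0 // ler_wpM2r ?invr_ge0 // ler_nat.
      exact: sum_short_cycles_le.
    rewrite -sum1_card natr_sum mulr_suml; apply: ler_sum => C.
    move=> /(short_cycles_card MMn) C0.
    have tC1 : t ^+ #|C| < 1 by rewrite exprn_ilt1 // -lt0n.
    rewrite mul1r; apply: ler_pM; rewrite ?invr_ge0 ?subr_ge0 ?(ltW tC1) //.
    - by rewrite !exprn_ge0.
    - by rewrite -exprM ler_wiXn2l ?(ltW t1) // mulnC ltnW // ltn_ceil.
    - rewrite lef_pV2 ?posrE ?subr_gt0 // lerD2l lerN2 -[leRHS]expr1.
      by rewrite ler_wiXn2l // ltW.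
  apply: ler_prod => C CF; rewrite expR_ge0 ge_expR_log_series //.
  rewrite exprn_ge0 // exprn_ilt1 // -lt0n; exact: (short_cycles_card MMn CF).
have lim : expR (- (S + #|short_cycles F M n|%:R * (t ^+ L / (1 - t))))
    @[L --> \oo] --> expR (- (S + #|short_cycles F M n|%:R * (0 / (1 - t)))).
  apply: continuous_cvg; first exact: continuous_expR.
  apply: cvgN; apply: cvgD; first exact: cvg_cst.
  apply: cvgMr; apply: cvgMl; apply: cvg_expr.
  by rewrite ger0_norm.
rewrite mul0r mulr0 addr0 in lim.
rewrite -(cvg_lim (@Rhausdorff R) lim).
apply: limr_le; first by apply/cvg_ex; eexists; exact: lim.
exact: nearW.
Qed.

End ShortCyclesProduct.

(** * Growth of the language *)

Section Subadditive.
Variables (R : realType) (u : nat -> R).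
Hypotheses (u_ge0 : forall n, 0 <= u n).
Hypothesis u_sub : forall m n, u (m + n)%N <= u m + u n.

Let ratios : set R := [set n%:R^-1 * u n | n in [set n | (0 < n)%N]].

Let ratios_inf : has_inf ratios.
Proof.
split; first by exists (1%:R^-1 * u 1%N), 1%N.
by exists 0 => _ [n _ <-]; rewrite mulr_ge0 // invr_ge0.
Qed.

Lemma subadditive_mul q m : u (q * m)%N <= q%:R * u m + u 0%N.
Proof.
elim: q => [|q IH]; first by rewrite mul0r add0r.
rewrite mulSn mulrS mulrDl mul1r; apply: le_trans (u_sub _ _) _.
by rewrite -addrA lerD2l.
Qed.

(** Divide [n] by [m]; the sum of all [u r] with [r < m] bounds the contribution of the
    remainder. *)
Lemma subadditive_bound m : (0 < m)%N ->
  exists c, forall n, u n <= n%:R * (m%:R^-1 * u m) + c.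
Proof.
move=> m0; exists (u 0%N + \sum_(r < m) u r) => n.
rewrite [in u n](divn_eq n m); apply: le_trans (u_sub _ _) _.
rewrite addrA lerD //; last first.
  rewrite (bigD1 (Ordinal (ltn_pmod n m0))) //= lerDl; exact: sumr_ge0.
apply: le_trans (subadditive_mul _ _) _; rewrite lerD2r mulrA ler_wpM2r //.
by rewrite ler_pdivlMr ?ltr0n // -natrM ler_nat leq_trunc_div.
Qed.

Lemma subadditive_cvg : n%:R^-1 * u n @[n --> \oo] --> inf ratios.
Proof.
apply/cvgrPdist_le => e e0.
have e2 : 0 < e / 2 by lra.
have [_ [m m0 <-] mlt] := inf_adherent e2 ratios_inf.
have [c Hc] := subadditive_bound m0.
near=> n.
have n0 : 0 < n%:R :> R by rewrite ltr0n; near: n; exists 1%N.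
have inf_le : inf ratios <= n%:R^-1 * u n.
  apply: ge_inf; first by case: ratios_inf.
  by exists n => //; rewrite /= -(ltr0n R).
rewrite distrC ger0_norm ?subr_ge0 // lerBlDr.
have cn : n%:R^-1 * c <= e / 2.
  rewrite mulrC ler_pdivrMr // -ler_pdivrMl //.
  near: n; exact: nbhs_infty_ger.
apply: (@le_trans _ _ (n%:R^-1 * (n%:R * (m%:R^-1 * u m) + c))).
  by rewrite ler_pM2l ?invr_gt0.
rewrite mulrDr mulKf ?gt_eqF //; lra.
Unshelve. all: by end_near. Qed.

Lemma subadditive_lim_le n : (0 < n)%N ->
  limn (fun n => n%:R^-1 * u n) <= n%:R^-1 * u n.
Proof.
move=> n0; rewrite (cvg_lim (@Rhausdorff R) subadditive_cvg).
by apply: ge_inf; [case: ratios_inf|exists n].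
Qed.

Lemma subadditive_lim_ge0 : 0 <= limn (fun n => n%:R^-1 * u n).
Proof.
rewrite (cvg_lim (@Rhausdorff R) subadditive_cvg).
apply: lb_le_inf; first by case: ratios_inf.
by move=> _ [n _ <-]; rewrite mulr_ge0 // invr_ge0.
Qed.

Lemma subadditive_lim_lt l : limn (fun n => n%:R^-1 * u n) < l ->
  exists c, forall n, u n <= n%:R * l + c.
Proof.
rewrite (cvg_lim (@Rhausdorff R) subadditive_cvg).
rewrite -subr_gt0 => l0; have [_ [m m0 <-] mlt] := inf_adherent l0 ratios_inf.
have [c Hc] := subadditive_bound m0; exists c => n.
by apply: le_trans (Hc n) _; rewrite lerD2r ler_wpM2l //; lra.
Qed.

End Subadditive.

(** * Entropy bounds on the number of words *)

Section Growth.
Variables (R : realType) (A : finType) (F : seq (seq A)).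
Notation X := (avoid F).

Lemma lang_img n : lang X n = img X (fun x => window x 0 n).
Proof.
apply/setP => w; rewrite [LHS]inE; apply/idP/idP.
  move=> /boolp.asboolP[x Xx /appears_tupleP[i <-]]; apply/mem_img.
  exists (translate i x); first exact: avoid_translate.
  by rewrite window_translate add0r.
move=> /mem_img[x Xx <-]; apply/boolp.asboolP.
by exists x => //; apply/appears_tupleP; exists 0.
Qed.

Lemma mem_lang x i n : X x -> window x i n \in lang X n.
Proof.
move=> Xx; rewrite inE; apply/boolp.asboolP.
by exists x => //; apply/appears_tupleP; exists i.
Qed.

Lemma card_lang_add m n :
  (#|lang X (m + n)| <= #|lang X m| * #|lang X n|)%N.
Proof.
rewrite -cardsX lang_img; pose g (x : config A) := (window x 0 m, window x m%:Z n).
apply: (@leq_trans #|img X g|).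
  apply: (card_img_le (h := id)) => // x y _ _ E.
  have /window_eqP E1 := congr1 fst E; have /window_eqP E2 := congr1 snd E.
  apply/window_eqP => k kmn; have [km|mk] := ltnP k m; first exact: E1.
  by rewrite !add0r; have := E2 (k - m)%N; rewrite -!PoszD subnKC //; apply; lia.
apply/subset_leq_card/fintype.subsetP => _ /mem_img[x Xx <-].
by rewrite finset.in_setX !mem_lang.
Qed.

Lemma nb_periodic_le_lang p : (0 < p)%N -> (nb_periodic X p <= #|lang X p|)%N.
Proof.
move=> p0; rewrite nb_periodicE // lang_img.
by apply: (card_img_le (h := id)) => // x [].
Qed.

Hypothesis X_nonempty : X !=set0.

Lemma card_lang_gt0 n : (0 < #|lang X n|)%N.
Proof.
have [x Xx] := X_nonempty; apply/card_gt0P; exists (window x 0 n).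
exact: mem_lang.
Qed.

Let u n : R := ln #|lang X n|%:R.

Let u_ge0 n : 0 <= u n.
Proof. by rewrite ln_ge0 // ler1n card_lang_gt0. Qed.

Let u_sub m n : u (m + n)%N <= u m + u n.
Proof.
rewrite -lnM ?posrE ?ltr0n ?card_lang_gt0 // -natrM ler_ln ?posrE ?ltr0n //.
- by rewrite ler_nat card_lang_add.
- exact: card_lang_gt0.
- by rewrite muln_gt0 !card_lang_gt0.
Qed.

Variable lambda : R.
Hypotheses (lambda_gt0 : 0 < lambda) (entropyX : entropy R X = ln lambda).

(** The entropy is the infimum of the ratios [ln #|lang X n| / n], so no multiplicative constant is
    lost. *)
Lemma card_lang_ge n : lambda ^+ n <= #|lang X n|%:R.
Proof.
have [->|n0] := posnP n; first by rewrite expr0 ler1n card_lang_gt0.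
have := subadditive_lim_le u_ge0 u_sub n0; rewrite [limn _]entropyX.
rewrite ler_pdivlMl ?ltr0n // mulr_natl -lnXn // ler_ln //.
  by rewrite posrE exprn_gt0.
by rewrite posrE ltr0n card_lang_gt0.
Qed.

Lemma lambda_ge1 : 1 <= lambda.
Proof.
rewrite -[lambda]lnK ?posrE // -expR0 ler_expR -entropyX.
exact: subadditive_lim_ge0.
Qed.

Lemma card_lang_le mu : lambda < mu ->
  exists c, 0 < c /\ forall n, #|lang X n|%:R <= c * mu ^+ n.
Proof.
move=> lm; have mu0 := lt_trans lambda_gt0 lm.
have [] := subadditive_lim_lt u_ge0 u_sub (l := ln mu).
  by rewrite [limn _]entropyX ltr_ln.
move=> c Hc; exists (expR c); split=> [|n]; first exact: expR_gt0.
rewrite -[leLHS]lnK ?posrE ?ltr0n ?card_lang_gt0 //.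
rewrite -[mu]lnK ?posrE // -expRM_natl -expRD ler_expR addrC.
exact: Hc.
Qed.

End Growth.

(** * The transition matrix *)

(** As [f] determines [pr], pairing it with [pr] does not change the size of its image, and the
    pairs are sorted by first component. *)
Lemma card_img_partition (A T S : finType) (D : set (config A))
    (f : config A -> T) (pr : config A -> S) (Q : pred S) :
  (forall x y, D x -> D y -> f x = f y -> pr x = pr y) ->
  (forall x, D x -> Q (pr x)) ->
  #|img D f| = (\sum_(s | Q s) #|img [set x | D x /\ pr x = s] f|)%N.
Proof.
move=> fpr DQ; pose g x := (pr x, f x).
have cardfg (D' : set (config A)) : (forall x, D' x -> D x) ->
    #|img D' f| = #|img D' g|.
  move=> D'D; apply/eqP; rewrite eqn_leq; apply/andP; split.
    by apply: (card_img_le (h := id)) => // x y _ _ [].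
  apply: (card_img_le (h := id)) => // x y /D'D Dx /D'D Dy E.
  by rewrite /g (fpr x y) //; congr (_, _).
rewrite cardfg // -sum1_card (partition_big fst Q) /=; last first.
  by move=> t /mem_img[x Dx <-]; exact: DQ.
apply: eq_bigr => s _; rewrite cardfg; last by move=> x [].
rewrite -sum1_card; apply: eq_bigl => t; apply/idP/idP.
  by move=> /andP[/mem_img[x Dx <-] /eqP <-]; exact: img_f.
move=> /mem_img[x [Dx <-] <-]; rewrite eqxx andbT; exact: img_f.
Qed.

Section TransitionMatrix.
Variables (R : realType) (A : finType) (F : seq (seq A)) (m' : nat).
Notation m := m'.+1.
Notation X := (avoid F).
Hypothesis Fm : forall w, w \in F -> (size w <= m)%N.

(** Edges of the [m]-block graph: the last [m - 1] letters of [u] are the first [m - 1] of [v]. *)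
Definition overlap (u v : m.-tuple A) : bool :=
  [forall j : 'I_m', tnth u (lift ord0 j) == tnth v (widen_ord (leqnSn m') j)].

Lemma overlap_window x y i j : overlap (window x i m) (window y j m) <->
  forall k, (k < m')%N -> x (i + k.+1%:Z) = y (j + k%:Z).
Proof.
split=> [/forallP H k km|H].
  by have /eqP := H (Ordinal km); rewrite !tnth_mktuple.
by apply/forallP => k; rewrite !tnth_mktuple /= H.
Qed.

Definition transition_matrix : 'M[R]_#|lang X m| :=
  \matrix_(i, j) (overlap (enum_val i) (enum_val j))%:R.

(** A path with [n] edges in the block graph, encoded as the word of [n + m] letters that it
    spells. *)
Definition paths n (u v : m.-tuple A) : {set (n + m).-tuple A} :=
  img [set x | [/\ X x, window x 0 m = u & window x n%:Z m = v]]
      (fun x => window x 0 (n + m)).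

Definition glue x y : config A := fun k => if k <= 0 then x k else y (k - 1).

(** A word of at most [m] letters starting at or before 0 ends by [m'], where the overlap still
    makes [glue x y] equal to [x]; one starting later lies in [y]. *)
Lemma avoid_glue x y : X x -> X y ->
  overlap (window x 0 m) (window y 0 m) -> X (glue x y).
Proof.
move=> Xx Xy /overlap_window xy w wF [i E].
have sw := Fm wF.
have [i0|i0] := leP i 0.
  apply: (Xx w wF); exists i; rewrite -[RHS]E; apply/eq_in_map => k.
  rewrite mem_iota add0n /glue => /andP[_ kw]; case: ifPn => // ik.
  have [l lE] : exists l : nat, i + k%:Z = l.+1%:Z.
    by exists (absz (i + k%:Z - 1)%R); lia.
  have km : (k < m)%N := leq_trans kw sw.
  by rewrite lE; have := xy l; rewrite !add0r => ->; [congr y|]; lia.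
apply: (Xy w wF); exists (i - 1); rewrite -[RHS]E; apply/eq_in_map => k _.
by rewrite /glue; case: ifPn => ik; [lia|congr y; lia].
Qed.

Lemma card_paths0 u v : u \in lang X m -> #|paths 0 u v| = (u == v).
Proof.
rewrite lang_img => /mem_img[x Xx xu].
have [<-{v}|uv] := eqVneq u v.
  rewrite (_ : paths 0 u u = finset.set1 (u : (0 + m).-tuple A)) ?cards1 //.
  apply/setP => w; rewrite finset.in_set1; apply/idP/eqP.
    by move=> /mem_img[y [_ <- _] <-].
  by move=> ->; apply/mem_img; exists x.
apply/eqP; rewrite cards_eq0; apply/eqP/setP => w; rewrite finset.in_set0.
by apply/negP => /mem_img[y [_ yu yv] _]; rewrite -yu -yv eqxx in uv.
Qed.

(** Both sides count the words read from 0 in points of [D]. Deleting the first letter sends a path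
    from [u] there, and gluing a point that starts with [u] in front inverts this. *)
Lemma card_pathsS n u v : u \in lang X m ->
  #|paths n.+1 u v| = (\sum_(u' in lang X m | overlap u u') #|paths n u' v|)%N.
Proof.
rewrite lang_img => /mem_img[xu Xxu xuu].
pose D := [set y | [/\ X y, overlap u (window y 0 m) & window y n%:Z m = v]].
transitivity #|img D (fun y => window y 0 (n + m))|; last first.
  rewrite (card_img_partition (pr := fun y => window y 0 m)
    (Q := fun u' => (u' \in lang X m) && overlap u u')); first last.
  - by move=> y [Xy uy _]; rewrite uy mem_lang.
  - move=> x y _ _ /window_eqP E; apply/window_eqP => k km.
    by apply: E; rewrite ltn_addl.
  rewrite lang_img; apply: eq_bigr => u' /andP[_ uu'].
  congr #|pred_of_set (img _ _)|; apply/seteqP; split=> y /=.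
    by move=> [[Xy _ yv] yu'].
  by move=> [Xy yu' yv]; split=> //; split=> //; rewrite yu'.
apply/eqP; rewrite eqn_leq; apply/andP; split.
  apply: (card_img_le (h := translate 1)).
    move=> x [Xx xu' xv]; split.
    - exact: avoid_translate.
    - rewrite window_translate -xu'; apply/overlap_window => k km.
      by congr x; lia.
    - by rewrite window_translate -xv; congr (window x _ m); lia.
  move=> x y [_ xu' _] [_ yu' _]; rewrite !window_translate => /window_eqP E.
  apply/window_eqP => -[|k] kn.
    by have /window_eqP := etrans xu' (esym yu'); apply.
  have := E k; rewrite addSn in kn; have -> : 0 + k.+1%:Z = 0 + 1 + k%:Z by lia.
  exact.
apply: (card_img_le (h := glue xu)).
  move=> y [Xy uy yv]; split.
  - by apply: avoid_glue => //; rewrite xuu.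
  - rewrite -xuu; apply/window_eqP => k km; rewrite /glue; case: ifPn => // k0.
    rewrite -xuu in uy; move/overlap_window: uy => /(_ k.-1) H.
    have -> : 0 + k%:Z = 0 + k.-1.+1%:Z by lia.
    by rewrite H; [congr y; lia|lia].
  - rewrite -yv; apply/window_eqP => k km; rewrite /glue.
    have -> : (n.+1%:Z + k%:Z <= 0) = false by lia.
    by congr y; lia.
move=> x y _ _ /window_eqP E; apply/window_eqP => k kn.
have := E k.+1; rewrite addSn ltnS => /(_ kn); rewrite /glue.
have -> : (0 + k.+1%:Z <= 0) = false by lia.
by have -> : 0 + k.+1%:Z - 1 = 0 + k%:Z :> int by lia.
Qed.

Lemma transition_matrix_exp n i j :
  (transition_matrix ^+ n) i j = #|paths n (enum_val i) (enum_val j)|%:R.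
Proof.
elim: n i => [|n IH] i.
  rewrite expr0 card_paths0 ?enum_valP // mxE.
  by rewrite (inj_eq enum_val_inj).
rewrite exprS card_pathsS ?enum_valP // mxE.
rewrite big_mkcondr [in RHS]big_enum_val natr_sum; apply: eq_bigr => l _.
rewrite mxE IH; by case: (overlap _ _); rewrite ?mul1r ?mul0r.
Qed.

Lemma sum_transition_matrix_exp n :
  \sum_i \sum_j (transition_matrix ^+ n) i j = #|lang X (n + m)|%:R.
Proof.
rewrite (lang_img _ (n + m)) (card_img_partition
  (pr := fun x => (window x 0 m, window x n%:Z m))
  (Q := fun p => (p.1 \in lang X m) && (p.2 \in lang X m))); first last.
- by move=> x Xx; rewrite !mem_lang.
- move=> x y _ _ /window_eqP E; congr (_, _); apply/window_eqP => k km.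
    by apply: E; lia.
  by have := E (n + k)%N; rewrite PoszD !add0r; apply; lia.
transitivity ((\sum_(u in lang X m) \sum_(v in lang X m)
    #|img [set x | X x /\ (window x 0 m, window x n%:Z m) = (u, v)]
          (fun x => window x 0 (n + m))|)%N%:R : R); last first.
  by rewrite pair_big; congr (_%:R); apply: eq_bigr => -[u v].
rewrite [in RHS]big_enum_val natr_sum; apply: eq_bigr => i _.
rewrite [in RHS]big_enum_val natr_sum; apply: eq_bigr => j _.
rewrite transition_matrix_exp; congr (#|pred_of_set (img _ _)|%:R).
apply/seteqP; split=> x /=; first by move=> [Xx -> ->].
by move=> [Xx E]; have := congr1 fst E; have := congr1 snd E => /= -> ->.
Qed.

(** The trace counts words of [p + m] letters whose first and last [m] letters agree. Such a word
    closes up to a point of period [p], from which it can be read off. *)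
Lemma trace_transition_matrix_exp p : (0 < p)%N ->
  \tr (transition_matrix ^+ p) <= (nb_periodic X p)%:R.
Proof.
move=> p0; pose D := [set x | X x /\ window x 0 m = window x (0 + p%:Z) m].
have -> : \tr (transition_matrix ^+ p) =
    #|img D (fun x => window x 0 (p + m))|%:R.
  rewrite (card_img_partition (pr := fun x => window x 0 m)
    (Q := mem (lang X m))); first last.
  - by move=> x [Xx _]; rewrite /= mem_lang.
  - move=> x y _ _ /window_eqP E; apply/window_eqP => k km.
    by apply: E; rewrite ltn_addl.
  rewrite big_enum_val natr_sum; apply: eq_bigr => i _.
  rewrite transition_matrix_exp; congr (#|pred_of_set (img _ _)|%:R).
  apply/seteqP; split=> x /=.
    by move=> [Xx xi xj]; split=> //; split=> //; rewrite add0r xi xj.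
  by move=> [[Xx E] xi]; rewrite -[p%:Z]add0r -E xi.
rewrite ler_nat nb_periodicE //.
apply: (card_img_le (h := fun x => closing x 0 p)).
  by move=> x [Xx rep]; exact: (periodic_closing Fm Xx p0 rep).
move=> x y [Xx xrep] [Xy yrep] /window_eqP E.
have xy : closing x 0 p = closing y 0 p.
  apply: (period_eq p0); [exact: closing_period..|].
  by move=> k kp; have := E k kp; rewrite !add0r.
apply/window_eqP => k kp.
by rewrite -(closing_nat p0 xrep kp) -(closing_nat p0 yrep kp) xy.
Qed.

End TransitionMatrix.

(** * Jacobi's formula and the determinant bound *)

Lemma deriv_prod (R : comNzRingType) (I : eqType) (r : seq I) (f : I -> {poly R}) :
  uniq r -> (\prod_(i <- r) f i)^`() =
  \sum_(i <- r) (f i)^`() * \prod_(j <- r | j != i) f j.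
Proof.
elim: r => [|a r IH]; first by rewrite !big_nil derivC.
rewrite cons_uniq => /andP[ar /IH {}IH].
rewrite !big_cons derivM IH eqxx /=; congr (_ * _ + _).
  rewrite big_seq [RHS]big_seq_cond; apply: eq_bigl => j.
  by case jr: (j \in r) => //=; apply/esym/negP => /eqP ja; rewrite -ja jr in ar.
rewrite mulr_sumr [LHS]big_seq [RHS]big_seq; apply: eq_bigr => i ir.
have ai : a != i by apply/negP => /eqP ai; rewrite ai ir in ar.
by rewrite big_cons ai mulrCA.
Qed.

(** The Leibniz expansion is differentiated row by row: the terms of row [i] form the determinant of
    [Q], which is expanded along that row. *)
Lemma deriv_det (R : comNzRingType) k (P : 'M[{poly R}]_k) :
  (\det P)^`() = \sum_i \sum_j (P i j)^`() * cofactor P i j.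
Proof.
have -> : (\det P)^`() =
    \sum_i \sum_(s : 'S_k) (-1) ^+ s * ((P i (s i))^`() *
      \prod_(j | j != i) P j (s j)).
  rewrite exchange_big /determinant raddf_sum; apply: eq_bigr => s _ /=.
  have sgn0 : ((-1 : {poly R}) ^+ s)^`() = 0.
    by case: (odd_perm s); rewrite ?expr1 ?expr0 -polyC1 -?polyCN derivC.
  by rewrite derivM sgn0 mul0r add0r deriv_prod ?index_enum_uniq // mulr_sumr.
apply: eq_bigr => i _.
pose Q : 'M[{poly R}]_k := \matrix_(l, j) if l == i then (P i j)^`() else P l j.
transitivity (\det Q).
  apply: eq_bigr => s _; congr (_ * _); rewrite [RHS](bigD1 i) //= mxE eqxx.
  by congr (_ * _); apply: eq_bigr => j /negbTE ji; rewrite mxE ji.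
rewrite (expand_det_row _ i); apply: eq_bigr => j _; rewrite mxE eqxx.
congr (_ * _); rewrite /cofactor; congr (_ * \det _).
apply/matrixP => l c; rewrite !mxE ifF //.
by apply/negbTE; rewrite eq_sym neq_lift.
Qed.

Lemma horner_bounded (R : realType) (q : {poly R}) :
  exists K, forall t, 0 <= t <= 1 -> `|q.[t]| <= K.
Proof.
exists (\sum_(i < size q) `|q`_i|) => t /andP[t0 t1]; rewrite horner_coef.
apply: le_trans (ler_norm_sum _ _ _) _; apply: ler_sum => i _.
by rewrite normrM ler_piMr // normrX ger0_norm // exprn_ile1.
Qed.

Section DeterminantBound.
Variables (R : realType) (k : nat) (T : 'M[R]_k).
Hypothesis T_ge0 : forall i j, 0 <= T i j.

Local Notation W n := (\sum_i \sum_j (T ^+ n) i j).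

(** Polynomial entries make the determinant differentiable by Jacobi's formula and the adjugate
    bounded on [[0, 1]]. *)
Let Pmx : 'M[{poly R}]_k := 1%:M - 'X *: map_mx polyC T.

Let horner_Pmx t : map_mx (horner_eval t) Pmx = 1%:M - t *: T.
Proof.
apply/matrixP => i j; rewrite !mxE /horner_eval hornerD hornerN hornerM hornerX.
rewrite hornerC; congr (_ - _).
by case: (i == j); rewrite ?mulr1n ?mulr0n hornerC.
Qed.

Let horner_det t : (\det Pmx).[t] = \det (1%:M - t *: T).
Proof. by rewrite -horner_Pmx det_map_mx. Qed.

Let horner_adj t i j : (\adj Pmx i j).[t] = (\adj (1%:M - t *: T)) i j.
Proof. by rewrite -horner_Pmx -map_mx_adj [RHS]mxE. Qed.

Let deriv_det_Pmx t :
  (\det Pmx)^`().[t] = - \tr (T *m \adj (1%:M - t *: T)).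
Proof.
rewrite deriv_det horner_sum -sumrN; apply: eq_bigr => i _.
rewrite horner_sum mxE -sumrN; apply: eq_bigr => j _.
rewrite -horner_adj [in RHS]mxE hornerM -mulNr; congr (_ * _).
rewrite !mxE derivB derivM derivX derivC mul1r mulr0 addr0.
have -> : ((i == j)%:R : {poly R})^`() = 0 by case: (i == j); exact: derivC.
by rewrite sub0r hornerN hornerC.
Qed.

(** The telescoping geometric sum combined with [adj P * P = det P]; being finite, it involves no
    convergence of matrix series. *)
Let adj_geometric t N : \adj (1%:M - t *: T) *m (1%:M - t ^+ N *: T ^+ N) =
  \det (1%:M - t *: T) *: \sum_(n < N) t ^+ n *: T ^+ n.
Proof.
have -> : 1%:M - t ^+ N *: T ^+ N = (1%:M - t *: T) *m \sum_(n < N) t ^+ n *: T ^+ n.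
  elim: N => [|N IH]; first by rewrite big_ord0 mulmx0 !expr0 scale1r subrr.
  rewrite big_ord_recr mulmxDr -IH mulmxBl mul1mx /=.
  rewrite -scalemxAl -scalemxAr scalerA -exprS -[T *m _]exprS.
  by rewrite addrA subrK.
by rewrite mulmxA mul_adj_mx mul_scalar_mx.
Qed.

Let exp_ge0 n i j : 0 <= (T ^+ n) i j.
Proof.
elim: n i j => [|n IH] i j; first by rewrite expr0 mxE ler0n.
by rewrite exprS mxE sumr_ge0 // => l _; rewrite mulr_ge0.
Qed.

Let W_ge0 n : 0 <= W n.
Proof. by rewrite sumr_ge0 // => i _; rewrite sumr_ge0. Qed.

Let adj_bounded : exists2 K, 0 < K & forall t i j, 0 <= t <= 1 ->
  `|\adj (1%:M - t *: T) i j| <= K.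
Proof.
have /boolp.choice[f Hf] : forall ij : 'I_k * 'I_k, exists K,
    forall t, 0 <= t <= 1 -> `|(\adj Pmx ij.1 ij.2).[t]| <= K.
  by move=> ij; exact: horner_bounded.
exists (1 + \sum_ij `|f ij|).
  by rewrite ltr_pwDl ?sumr_ge0.
move=> t i j t01; rewrite -horner_adj; apply: le_trans (Hf (i, j) t t01) _.
apply: le_trans (ler_norm _) _; rewrite (bigD1 (i, j)) //= addrCA lerDl.
by rewrite addr_ge0 // sumr_ge0.
Qed.

(* With [D t = det (1 - t T)] and [q] the [N]-th partial sum of
   [sum_p tr (T^p) t^p / p], Jacobi's formula and the geometric sum give
   [D' + D q' = - t^N tr (adj (1 - t T) T^(N+1))], so that [D e^q] is almost
   constant, equal to 1; and the entries of [D sum_(n < N) t^n T^n] stay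
   bounded because they are close to those of [adj (1 - t T)]. *)
Lemma sum_exp_trace_bounded : exists K, forall b S, 0 <= b <= 1 ->
  (forall N, \sum_(1 <= p < N.+1) \tr (T ^+ p) / p%:R * b ^+ p <= S) ->
  b ^+ n * W n @[n --> \oo] --> (0 : R) ->
  forall N, expR (- S) * \sum_(n < N) b ^+ n * W n <= K.
Proof.
have [K K0 HK] := adj_bounded.
(* The factor 2 comes from [D_ge]; the two terms are those of [sumD] at an index where
   [b^M W M <= 1]. The bound depends neither on [b] nor on [S]. *)
exists (2 * (K * (k * k)%:R + k%:R * K)) => b S /andP[b0 b1] HS Wlim N.
have small e : 0 < e -> exists2 N', (N < N')%N & b ^+ N' * W N' <= e.
  move=> e0; have [M _ HM] := (cvgrPdist_le _ _).1 Wlim e e0.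
  exists (maxn M N.+1); first by rewrite leq_max ltnSn orbT.
  have := HM (maxn M N.+1) (leq_maxl _ _); rewrite sub0r normrN.
  by apply: le_trans; exact: ler_norm.
pose D t := \det (1%:M - t *: T).
pose q N' := exp_series_poly (fun p => \tr (T ^+ p)) N'.
have tr_ge0 p : 0 <= \tr (T ^+ p) by rewrite sumr_ge0.
have q_le t N' : 0 <= t <= b -> (q N').[t] <= S.
  move=> /andP[t0 tb]; apply: le_trans (HS N'); rewrite horner_exp_series_poly.
  apply: ler_sum => p _; rewrite ler_wpM2l ?mulr_ge0 ?invr_ge0 //.
  by rewrite lerXn2r ?nnegrE // (le_trans t0).
have D_ge : expR (- S) / 2 <= D b.
  (* This threshold keeps the total decrease of [D e^q] on [[0, b]] below 1/2. *)
  have [|[//|N'] NN' HN'] := small ((2 * (K * expR S))^-1).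
    by rewrite invr_gt0 !mulr_gt0 // expR_gt0.
  have := @mul_expR_lower_bound _ (\det Pmx) (q N') b
    (b ^+ N' * (K * W N'.+1) * expR S) b0.
  rewrite !horner_det scale0r subr0 det1 horner0_exp_series_poly expR0 mulr1.
  move=> H.
  have {}H : 1 - b ^+ N' * (K * W N'.+1) * expR S * b <= D b * expR (q N').[b].
    apply: H => t tb; have /andP[t0 t_le_b] := tb.
    have t01 : 0 <= t <= 1 by rewrite t0 (le_trans t_le_b).
    rewrite hornerD hornerM horner_det deriv_det_Pmx deriv_exp_series_poly.
    have -> : - \tr (T *m \adj (1%:M - t *: T)) + \det (1%:M - t *: T) *
        (\sum_(n < N') \tr (T ^+ n.+1) * t ^+ n) =
        - (t ^+ N' * \tr (\adj (1%:M - t *: T) *m T ^+ N'.+1)).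
      have -> : \det (1%:M - t *: T) * (\sum_(n < N') \tr (T ^+ n.+1) * t ^+ n) =
          \tr ((\det (1%:M - t *: T) *: \sum_(n < N') t ^+ n *: T ^+ n) *m T).
        rewrite -scalemxAl mxtraceZ mulmx_suml raddf_sum; congr (_ * _).
        apply: eq_bigr => n _ /=.
        by rewrite -scalemxAl mxtraceZ mulrC -[T ^+ n *m T]exprSr.
      rewrite -adj_geometric -mulmxA mulmxBl mul1mx mulmxBr raddfB /=.
      rewrite mxtrace_mulC addKr -scalemxAl -scalemxAr mxtraceZ.
      by rewrite -[T ^+ N' *m T]exprSr.
    apply: (@le_trans _ _ (- (b ^+ N' * (K * W N'.+1)) * expR (q N').[t])).
      rewrite mulNr lerN2 ler_wpM2l ?mulr_ge0 ?exprn_ge0 ?(ltW K0) //.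
      by rewrite ler_expR q_le.
    rewrite ler_wpM2r ?expR_ge0 // lerN2.
    apply: (@le_trans _ _ (t ^+ N' * (K * W N'.+1))); last first.
      rewrite ler_wpM2r ?mulr_ge0 ?(ltW K0) // lerXn2r ?nnegrE //.
    rewrite ler_wpM2l ?exprn_ge0 //.
    rewrite exchange_big mulr_sumr; apply: ler_sum => i _.
    rewrite mxE mulr_sumr; apply: ler_sum => j _.
    rewrite ler_wpM2r //; apply: le_trans (ler_norm _) _; exact: HK.
  have H2 : 1 / 2 <= D b * expR (q N').[b].
    apply: le_trans H.
    rewrite invfM mulrC ler_pdivlMr ?mulr_gt0 ?expR_gt0 // [b ^+ _]exprS in HN'.
    lra.
  have Db : 0 < D b.
    rewrite -(pmulr_lgt0 _ (expR_gt0 (q N').[b])); lra.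
  rewrite expRN mulrC ler_pdivrMr ?expR_gt0 // -[2^-1]mul1r.
  apply: le_trans H2 _.
  by rewrite ler_pM2l // ler_expR q_le // b0 lexx.
have [N' NN' HN'] := small 1 ltr01.
have sumD M : D b * (\sum_(n < M) b ^+ n * W n) <=
    K * (k * k)%:R + k%:R * K * (b ^+ M * W M).
  have -> : D b * (\sum_(n < M) b ^+ n * W n) =
    \sum_i \sum_j (D b *: \sum_(n < M) b ^+ n *: T ^+ n) i j.
    rewrite mulr_sumr.
    under [RHS]eq_bigr => i _ do under eq_bigr => j _ do
      rewrite mxE summxE mulr_sumr.
    under [RHS]eq_bigr => i _ do rewrite exchange_big.
    rewrite [RHS]exchange_big; apply: eq_bigr => n _.
    rewrite !mulr_sumr; apply: eq_bigr => i _.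
    by rewrite !mulr_sumr; apply: eq_bigr => j _; rewrite mxE.
  have {HK} := fun i j => HK b i j (introT andP (conj b0 b1)).
  rewrite -adj_geometric mulmxBr mulmx1 -scalemxAr.
  move: (\adj _) => B HK.
  under eq_bigr => i _ do under eq_bigr => j _ do rewrite !mxE.
  under eq_bigr => i _ do rewrite sumrB.
  rewrite sumrB; apply: lerD.
    apply: (@le_trans _ _ (\sum_(i < k) \sum_(j < k) K)).
      apply: ler_sum => i _; apply: ler_sum => j _.
      by apply: le_trans (ler_norm _) _; exact: HK.
    by rewrite !sumr_const !card_ord -mulrnA mulr_natr.
  rewrite -sumrN.
  apply: (@le_trans _ _ (\sum_(i < k) K * (b ^+ M * W M))); last first.
    by rewrite sumr_const card_ord -[leLHS]mulr_natl mulrA.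
  apply: ler_sum => i _; rewrite -sumrN exchange_big mulr_sumr mulr_sumr.
  apply: ler_sum => j _; rewrite mulrCA -mulrN ler_wpM2l ?exprn_ge0 //.
  rewrite mulr_sumr -sumrN; apply: ler_sum => l _.
  rewrite -mulNr ler_wpM2r //; apply: le_trans (ler_norm _) _.
  by rewrite normrN; exact: HK.
have sumN : \sum_(n < N) b ^+ n * W n <= \sum_(n < N') b ^+ n * W n.
  rewrite -(subnKC (ltnW NN')) big_split_ord /= lerDl sumr_ge0 // => n _.
  by rewrite mulr_ge0 ?exprn_ge0.
have sum0 : 0 <= \sum_(n < N) b ^+ n * W n.
  by rewrite sumr_ge0 // => n _; rewrite mulr_ge0 ?exprn_ge0.
rewrite -ler_pdivrMl // mulrA [2^-1 * _]mulrC.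
have e0 : 0 <= expR (- S) / 2 by rewrite divr_ge0 ?expR_ge0.
apply: le_trans (ler_pM e0 sum0 D_ge sumN) _.
apply: le_trans (sumD N') _; rewrite lerD2l ler_piMr // mulr_ge0 //.
exact: ltW.
Qed.

End DeterminantBound.

(** * Convergence and divergence of the zeta function *)

Section ZetaConvergence.
Variables (R : realType) (A : finType) (F : seq (seq A)) (lambda t : R).
Notation X := (avoid F).
Hypotheses (X_nonempty : X !=set0) (lambda_gt0 : 0 < lambda).
Hypothesis entropyX : entropy R X = ln lambda.
Hypotheses (t_ge0 : 0 <= t) (t_lt : t < lambda^-1).

Lemma lt_inv_lambda_lt1 : t < 1.
Proof.
apply: lt_le_trans t_lt _; rewrite invf_le1 //.
exact: (lambda_ge1 X_nonempty).
Qed.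

Lemma card_lang_geometric : exists c r, [/\ 0 < c, 0 <= r < 1 &
  forall n, #|lang X n|%:R * t ^+ n <= c * r ^+ n].
Proof.
have tl : t * lambda < 1 by rewrite -ltr_pdivlMr // mul1r.
(* Then [mu * t < 1] because [t < 1]; this choice also covers [t = 0]. *)
pose mu := lambda + (1 - t * lambda) / 2.
have lm : lambda < mu by rewrite /mu; lra.
have [c [c0 Hc]] := card_lang_le X_nonempty lambda_gt0 entropyX lm.
exists c, (mu * t); split=> // [|n].
  rewrite mulr_ge0 ?(ltW (lt_trans lambda_gt0 lm)) //=.
  have := lt_inv_lambda_lt1; rewrite /mu; nra.
by rewrite exprMn mulrA ler_wpM2r ?exprn_ge0.
Qed.

(** Comparison with a geometric series. Uniformity in [K] matters: the range of the sum in
    [prob_empty_ge] grows with [n]. *)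
Lemma sum_nb_periodic_tail e : 0 < e -> exists M0, forall M K, (M0 <= M)%N ->
  \sum_(M.+1 <= p < K) (nb_periodic X p)%:R * t ^+ p <= e.
Proof.
move=> e0; have [c [r [c0 /andP[r0 r1] Hcr]]] := card_lang_geometric.
have lim : c * (r ^+ n / (1 - r)) @[n --> \oo] --> c * (0 / (1 - r)).
  by apply: cvgMr; apply: cvgMl; apply: cvg_expr; rewrite ger0_norm.
rewrite mul0r mulr0 in lim; have [M0 _ HM0] := (cvgrPdist_le _ _).1 lim e e0.
exists M0 => M K /HM0; rewrite sub0r normrN => /(le_trans (ler_norm _)).
apply: le_trans; apply: (@le_trans _ _ (\sum_(M.+1 <= p < K) c * r ^+ p)).
  rewrite big_nat [leRHS]big_nat; apply: ler_sum => p /andP[Mp _].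
  apply: le_trans (Hcr p); rewrite ler_wpM2r ?exprn_ge0 // ler_nat.
  by apply: nb_periodic_le_lang; apply: leq_trans Mp.
rewrite -mulr_sumr ler_pM2l // -{1}[M.+1]add0n big_addn big_mkord.
under eq_bigr do rewrite exprD mulrC.
rewrite -mulr_sumr; apply: (@le_trans _ _ (r ^+ M.+1 / (1 - r))); last first.
  by rewrite ler_wpM2r ?invr_ge0 ?subr_ge0 ?(ltW r1) // ler_wiXn2l // ltW.
rewrite ler_wpM2l ?exprn_ge0 // -[leRHS]mul1r ler_pdivlMr ?subr_gt0 //.
by rewrite mulrC geometric_sum lerBlDr lerDl exprn_ge0.
Qed.

Lemma zeta_partial_cvg : exists Z, [/\ zeta X t = expR Z,
  zeta_partial F t K @[K --> \oo] --> Z & forall K, zeta_partial F t K <= Z].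
Proof.
have term_ge0 p : 0 <= (nb_periodic X p)%:R / p%:R * t ^+ p :> R.
  by rewrite !mulr_ge0 ?invr_ge0 ?exprn_ge0.
(* The series in [zeta] is the limit of sums over [p < n], whereas [zeta_partial] includes [p = K]:
   the indices differ by one. *)
pose f n : R := \sum_(1 <= p < n) (nb_periodic X p)%:R / p%:R * t ^+ p.
have f_nd : nondecreasing_seq f.
  apply/nondecreasing_seqP => n; rewrite /f; case: n => [|n].
    by rewrite !big_geq.
  by rewrite [leRHS]big_nat_recr //= lerDl.
have [M0 HM0] := sum_nb_periodic_tail ltr01.
have f_cvg : cvgn f.
  apply: nondecreasing_is_cvgn => //.
  exists (f M0.+1 + 1) => _ [n _ <-].
  have [nM|Mn] := leqP n M0.+1.
    by rewrite -[leLHS]addr0 lerD ?f_nd.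
  rewrite /f (big_cat_nat _ (ltnW Mn)) //; apply: lerD => //.
  apply: le_trans (HM0 M0 n (leqnn _)); rewrite big_nat [leRHS]big_nat.
  apply: ler_sum => p /andP[Mp _]; rewrite ler_wpM2r ?exprn_ge0 //.
  by rewrite ler_pdivrMr ?ltr0n ?(leq_trans _ Mp) // ler_peMr // ler1n (leq_trans _ Mp).
exists (limn f); split=> //.
- by rewrite (_ : zeta_partial F t = fun K => f K.+1) // cvg_shiftS.
- by move=> K; exact: (nondecreasing_cvgn_le f_nd f_cvg K.+1).
Qed.

End ZetaConvergence.

(** Take [b = (1 - d) / lambda]. The entries of [T^n] add up to at least [lambda^n], so
    [sum_exp_trace_bounded] bounds [(zeta b)^-1] times the sum of the [(1 - d)^n] by [K]. Partial
    sums reach [1 / (2 d)], whence [(zeta b)^-1 <= 2 d K]. *)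
Lemma zeta_unbounded (R : realType) (A : finType) (F : seq (seq A)) (lambda e : R) :
  avoid F !=set0 -> 0 < lambda -> entropy R (avoid F) = ln lambda -> 0 < e ->
  exists b, [/\ 0 <= b, b < lambda^-1 & (zeta (avoid F) b)^-1 <= e].
Proof.
move=> X0 l0 entX e0.
pose m' := (\max_(w <- F) size w)%N.
have Fm w : w \in F -> (size w <= m'.+1)%N.
  by move=> wF; apply/leqW/leq_bigmax_seq.
pose T := transition_matrix R F m'.
have T_ge0 i j : 0 <= T i j by rewrite mxE.
have [K HK] := sum_exp_trace_bounded T_ge0.
(* Chosen so that [0 < d < 1] and [2 d K <= e], whatever the sign of [K]. *)
pose d := e / (4 * (`|K| + 1) + e).
have K1 : 0 < `|K| + 1 by rewrite ltr_pwDr.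
have den0 : 0 < 4 * (`|K| + 1) + e by rewrite addr_gt0 // mulr_gt0.
have d0 : 0 < d by rewrite divr_gt0.
have d1 : d < 1 by rewrite ltr_pdivrMr // mul1r ltrDr mulr_gt0.
have dK : 2 * d * K <= e.
  have : d * (4 * (`|K| + 1) + e) = e by rewrite divfK // gt_eqF.
  have := ler_norm K; nra.
pose b := (1 - d) / lambda.
have b0 : 0 <= b by rewrite divr_ge0 ?subr_ge0 ?ltW.
have bl : b < lambda^-1.
  by rewrite -[ltRHS]mul1r ltr_pM2r ?invr_gt0 // gtrDl oppr_lt0.
have b1 : b < 1 by exact: lt_inv_lambda_lt1 X0 l0 entX bl.
exists b; split=> //.
have [Z [-> _ HZ]] := zeta_partial_cvg X0 l0 entX b0 bl.
rewrite -expRN.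
have trS N : \sum_(1 <= p < N.+1) \tr (T ^+ p) / p%:R * b ^+ p <= Z.
  apply: le_trans (HZ N); rewrite /zeta_partial big_nat [leRHS]big_nat.
  apply: ler_sum => p /andP[p0 _]; rewrite ler_wpM2r ?exprn_ge0 //.
  by rewrite ler_wpM2r ?invr_ge0 // trace_transition_matrix_exp.
have {trS}HK := HK b Z _ trS _.
have W_lim : b ^+ n * (\sum_i \sum_j (T ^+ n) i j) @[n --> \oo] --> (0 : R).
  have [c [r [c0 /andP[r0 r1] Hcr]]] := card_lang_geometric X0 l0 entX b0 bl.
  have ub n : `|b ^+ n * (\sum_i \sum_j (T ^+ n) i j)| <=
      #|lang (avoid F) m'.+1|%:R * (c * r ^+ n).
    rewrite sum_transition_matrix_exp // ger0_norm ?mulr_ge0 ?exprn_ge0 //.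
    apply: le_trans (ler_wpM2l _ (Hcr n)) => //; rewrite mulrA -natrM mulrC.
    by rewrite ler_wpM2r ?exprn_ge0 // ler_nat mulnC card_lang_add.
  apply/norm_cvg0P; apply: (@squeeze_cvgr _ _ _ _ (cst 0)
    (fun n => #|lang (avoid F) m'.+1|%:R * (c * r ^+ n))).
  - by near=> n; rewrite normr_ge0 ub.
  - exact: cvg_cst.
  - rewrite -[X in _ --> X](mulr0 #|lang (avoid F) m'.+1|%:R) -(mulr0 c).
    by apply: cvgMr; apply: cvgMr; apply: cvg_expr; rewrite ger0_norm.
have {W_lim}HK N : expR (- Z) *
    \sum_(n < N) b ^+ n * (\sum_i \sum_j (T ^+ n) i j) <= K.
  by apply: HK => //; rewrite b0 ltW.
have [N HN] : exists N, (1 - d) ^+ N <= 2^-1.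
  have lim : (1 - d) ^+ n @[n --> \oo] --> (0 : R).
    by apply: cvg_expr; rewrite ger0_norm; lra.
  have [N _ /(_ N (leqnn N))] := (cvgrPdist_le _ _).1 lim 2^-1 ltac:(lra).
  rewrite sub0r normrN => H; exists N; exact: le_trans (ler_norm _) H.
have geo : expR (- Z) * \sum_(n < N) (1 - d) ^+ n <= K.
  apply: le_trans (HK N); rewrite ler_wpM2l ?expR_ge0 //.
  apply: ler_sum => n _; rewrite sum_transition_matrix_exp //.
  have -> : (1 - d) ^+ n = b ^+ n * lambda ^+ n.
    by rewrite -exprMn divfK // gt_eqF.
  rewrite ler_wpM2l ?exprn_ge0 //.
  apply: le_trans (card_lang_ge X0 l0 entX _).
  by rewrite ler_weXn2l ?leq_addr // (lambda_ge1 X0 l0 entX).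
have gs := geometric_sum (1 - d) N.
have : d * (expR (- Z) * \sum_(n < N) (1 - d) ^+ n) <= d * K.
  by rewrite ler_pM2l.
rewrite mulrCA; have -> : d * \sum_(n < N) (1 - d) ^+ n = 1 - (1 - d) ^+ N.
  by rewrite -gs; congr (_ * _); lra.
have := expR_ge0 (- Z); nra.
Unshelve. all: by end_near. Qed.

(** * The limit of the emptiness probability *)

Theorem theorem1p1 (R : realType) (A : finType) (X : set (config A))
    (lambda : R) (X_SFT : is_SFT X) (X_nonempty : X !=set0)
    (lambda_gt0 : 0 < lambda) (entropyX : entropy R X = ln lambda)
    (alpha : R) (alpha_ge0 : 0 <= alpha) (alpha_le1 : alpha <= 1) :
  (fun n : nat => bernoulli_subset alpha (lang X n) (empty_event X n)) @ \oo -->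
    (if alpha < lambda^-1 then (zeta X alpha)^-1 else 0 : R).
Proof.
have [F XF] := X_SFT; subst X.
pose m := (\max_(w <- F) size w)%N.
have Fm w : w \in F -> (size w <= m)%N by move=> wF; exact: leq_bigmax_seq.
have a01 : 0 <= alpha <= 1 by rewrite alpha_ge0.
have trunc b e : 0 <= b -> b < lambda^-1 -> 0 < e ->
    exists M0, forall M, (M0 <= M)%N -> expR (- zeta_partial F b M) <= (zeta (avoid F) b)^-1 + e.
  move=> b0 bl e0.
  have [Z [-> Zlim _]] := zeta_partial_cvg X_nonempty lambda_gt0 entropyX b0 bl.
  have lim : expR (- zeta_partial F b K) @[K --> \oo] --> expR (- Z).
    by apply: continuous_cvg; [exact: continuous_expR|exact: cvgN].
  have [M0 _ HM0] := (cvgrPdist_le _ _).1 lim e e0.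
  exists M0 => M /HM0; rewrite -expRN distrC ler_norml => /andP[_].
  by rewrite lerBlDl.
case: ifPn => [al|]; last rewrite -leNgt => la; apply/cvgrPdist_le => e e0.
- have [M1 HM1] := trunc alpha e alpha_ge0 al e0.
  have [M2 HM2] := sum_nb_periodic_tail X_nonempty lambda_gt0 entropyX alpha_ge0 al e0.
  have a1 := lt_inv_lambda_lt1 X_nonempty lambda_gt0 entropyX al.
  have [Z [zE _ HZ]] :=
    zeta_partial_cvg X_nonempty lambda_gt0 entropyX alpha_ge0 al.
  (* [M * M <= n] makes the short cycles disjoint, and [m <= n] lets repetitions of words of length
     [n] close up inside [X]. *)
  pose M := maxn M1 M2; exists (maxn (M * M) m) => // n /=.
  rewrite geq_max => /andP[MMn mn].
  have Fn w : w \in F -> (size w <= n)%N by move=> /Fm /leq_trans; exact.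
  rewrite distrC ler_norml lerBrDl; apply/andP; split.
  + apply: le_trans (prob_empty_ge a01 MMn Fn); apply: lerB; last first.
      by apply: HM2; rewrite leq_maxr.
    rewrite zE -expRN; apply: prod_short_cycles_ge => //.
    by rewrite alpha_ge0.
  + rewrite lerBlDl; apply: le_trans (prob_empty_le F a01 MMn) _.
    apply: le_trans (prod_short_cycles_le F MMn a01) _.
    by rewrite HM1 // leq_maxl.
- have e2 : 0 < e / 2 by rewrite divr_gt0.
  have [b [b0 bl zb]] := zeta_unbounded X_nonempty lambda_gt0 entropyX e2.
  have [M HM] := trunc b (e / 2) b0 bl e2.
  have b1 := lt_inv_lambda_lt1 X_nonempty lambda_gt0 entropyX bl.
  exists (M * M)%N => // n /= MMn.
  rewrite distrC subr0 ger0_norm; last first.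
    apply: sumr_ge0 => omega _; apply: prodr_ge0 => w _.
    by case: ifP; rewrite ?subr_ge0.
  apply: le_trans (prob_empty_le F a01 MMn) _.
  (* Each factor decreases in the parameter and [b < 1 / lambda <= alpha], so the bound at [b],
     where the zeta series converges to a large value, applies at [alpha]. *)
  apply: (@le_trans _ _ (\prod_(C in short_cycles F M n) (1 - b ^+ #|C|))).
    apply: ler_prod => C _; rewrite subr_ge0 exprn_ile1 //= lerD2l lerN2.
    by rewrite lerXn2r ?nnegrE // ltW // (lt_le_trans bl).
  have b01 : 0 <= b <= 1 by rewrite b0 ltW.
  apply: le_trans (prod_short_cycles_le F MMn b01) _.
  by apply: le_trans (HM M (leqnn M)) _; lra.
Qed.
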